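(* Let $(X,d)$ be a compact metric space, $T:X\to X$ a bi-Lipschitz transformation (a bijection with $T$ and $T^{-1}$ Lipschitz), and $\mu$ a $T$-invariant Borel probability measure on $X$ whose correlation dimension $C_\mu$ exists. Let $\varphi:X\to(0,+\infty)$ be Lipschitz, let $\Psi$ be the suspension flow over $T$ with height function $\varphi$ on the suspension space $Y$, and let $\nu$ be the $\Psi$-invariant probability measure on $Y$ associated with $\mu$. Then the correlation dimension $C_\nu$ of $\nu$ with respect to the Bowen–Walters distance on $Y$ exists and $$C_\nu=C_\mu+1.$$
   Context: For a Borel probability measure $m$ on a metric space, $\underline{C}_m=\liminf_{r\to0}\frac{\log\int m(B(x,r))\,dm(x)}{\log r}$, $\overline{C}_m$ is the corresponding limsup, and if they are equal the common value is the correlation dimension $C_m$. Suspension flow: $Y=\{(u,s)\in X\times\mathbb{R}:0\le s\le\varphi(u)\}$, where $(u,\varphi(u))$ and $(Tu,0)$ are identified for all $u\in X$; the flow acts by $\Psi_t(u,s)=(u,s+t)$ (using the identification). The measure $\nu$ is given by $$\int_Y g\,d\nu=\frac{\int_X\int_0^{\varphi(x)}g(x,s)\,ds\,d\mu(x)}{\int_X\varphi\,d\mu}$$ for every continuous $g:Y\to\mathbb{R}$. Bowen–Walters distance: first consider the suspension space with constant height function $1$. For $x,y\in X$ and $t\in[0,1]$, the length of the horizontal segment $[(x,t),(y,t)]$ is $\alpha_h((x,t),(y,t))=(1-t)d(x,y)+t\,d(Tx,Ty)$. For $(x,t),(y,s)$ on the same orbit of the (height $1$) suspension flow, the length of the vertical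 segment $[(x,t),(y,s)]$ is $\alpha_v((x,t),(y,s))=\inf\{|r|:r\in\mathbb{R},\ \Psi_r(x,t)=(y,s)\}$. The distance $d_1((x,t),(y,s))$ is the infimum of the lengths of paths between $(x,t)$ and $(y,s)$ composed of finitely many horizontal and vertical segments. For general $\varphi$, the Bowen–Walters distance on $Y$ is $$d_Y((x,t),(y,s))=d_1\left(\left(x,\tfrac{t}{\varphi(x)}\right),\left(y,\tfrac{s}{\varphi(y)}\right)\right).$$ *)

(* Defs.v *)
From HB Require Import structures.
From Stdlib Require Import Relation_Operators.
From mathcomp Require Import all_boot all_order all_algebra.
From mathcomp Require Import all_classical all_reals all_analysis.
Import Order.TTheory GRing.Theory Num.Theory.
Import numFieldNormedType.Exports.

Set Implicit Arguments.
Unset Strict Implicit.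
Unset Printing Implicit Defensive.

Local Open Scope classical_set_scope.
Local Open Scope ring_scope.

(* Measurable types of the library are pointed; a space carrying a probability
   measure is nonempty, so a base point is no restriction. *)
#[short(type="pmetricType")]
HB.structure Definition PointedMetric (R : numDomainType) :=
  { X of Metric R X & isPointed X }.

Definition borel (X : ptopologicalType) := g_sigma_algebraType (@open X).

Definition mlipschitz (R : realType) (X Z : metricType R) (f : X -> Z) :=
  exists K : R, forall x y, mdist (f x) (f y) <= K * mdist x y.

Definition bilipschitz (R : realType) (X Z : metricType R) (f : X -> Z) :=
  mlipschitz f /\ exists g : Z -> X, [/\ cancel f g, cancel g f & mlipschitz g].

Section correlation_dimension.
Context {R : realType} {d : measure_display} {X : measurableType d}.
Variables (m : probability X R) (dist : X -> X -> R).
Local Open Scope ereal_scope.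

Definition correlation_integral (r : R) : \bar R :=
  \int[m]_x m [set y | (dist x y < r)%R].

Definition correlation_ratio (r : R) : \bar R :=
  lne (correlation_integral r) / (ln r)%:E.

Definition lower_correlation_dimension : \bar R :=
  limf_einf correlation_ratio 0%R^'+.

Definition upper_correlation_dimension : \bar R :=
  limf_esup correlation_ratio 0%R^'+.

Definition has_correlation_dimension (C : \bar R) :=
  lower_correlation_dimension = C /\ upper_correlation_dimension = C.

End correlation_dimension.

Section suspension.
Context {R : realType} {X : pmetricType R}.
Variables (T : X -> X) (phi : X -> {posnum R}).

Definition susp_dom : set (X * R) := [set p | 0 <= p.2 <= (phi p.1)%:num].

Definition susp_glue : susp_dom -> susp_dom -> Prop :=
  clos_refl_sym_trans _ (fun p q : susp_dom =>
    (val p).2 = (phi (val p).1)%:num /\ val q = (T (val p).1, 0)).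

Definition susp_eq : rel susp_dom := fun p q => `[< susp_glue p q >].

Lemma susp_eq_refl : reflexive susp_eq.
Proof. by move=> p; apply/asboolP; exact: rst_refl. Qed.

Lemma susp_eq_sym : symmetric susp_eq.
Proof. by move=> p q; apply/asboolP/asboolP => pq; exact: rst_sym. Qed.

Lemma susp_eq_trans : transitive susp_eq.
Proof.
by move=> q p r /asboolP pq /asboolP qr; apply/asboolP; exact: rst_trans qr.
Qed.

Canonical susp_equiv := EquivRel susp_eq susp_eq_refl susp_eq_sym susp_eq_trans.

(* The suspension space carries the quotient topology, which is the topology of
   the Bowen-Walters distance when X is compact, T is a homeomorphism and phi is
   continuous. *)
Definition susp_space : Type := quotient_topology {eq_quot susp_equiv}%qT.

HB.instance Definition _ := Topological.on susp_space.
HB.instance Definition _ := Quotient.on susp_space.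

Lemma susp_base_subproof : (point, 0) \in susp_dom.
Proof. by rewrite inE /susp_dom /= lexx /=. Qed.

Definition susp_base : susp_dom := exist _ (point, 0) susp_base_subproof.

HB.instance Definition _ :=
  isPointed.Build susp_space (\pi_susp_space susp_base)%qT.

(* The point (x, s) of the suspension space, for 0 <= s <= phi x (and an
   irrelevant default value otherwise). *)
Definition susp_pt (x : X) (s : R) : susp_space :=
  (\pi_susp_space (insubd susp_base (x, s)))%qT.

(* The identification propagated to the pairs (u, s) with s outside of
   [0, phi u]: crossing the roof over u leads to the fibre over T u. *)
Definition susp_orbit_eq : X * R -> X * R -> Prop :=
  clos_refl_sym_trans _ (fun p q => q = (T p.1, p.2 - (phi p.1)%:num)).

(* The time-t map of the flow on classes of pairs.  When T is bijective and phi
   is bounded away from 0, the set below is a singleton for every t and y. *)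
Definition susp_flow (t : R) (y : susp_space) : susp_space :=
  let p := val (repr y) in
  get [set z : susp_space | susp_orbit_eq (p.1, p.2 + t) (val (repr z))].

(* Invariance of nu under the flow follows from this formula when mu is
   T-invariant. *)
Definition is_suspension_measure
    (mu : probability (borel X) R) (nu : probability (borel susp_space) R) :=
  forall g : susp_space -> R, continuous g ->
    \int[nu]_y g y =
      (\int[mu]_x \int[lebesgue_measure]_(s in `[0, (phi x)%:num])
         g (susp_pt x s)) / \int[mu]_x (phi x)%:num.

End suspension.

Definition unit_height {R : realType} {X : pmetricType R} : X -> {posnum R} :=
  fun=> 1%:pos.

Definition unit_susp {R : realType} {X : pmetricType R} (T : X -> X) : Type :=
  susp_space T unit_height.

Section bowen_walters.
Context {R : realType} {X : pmetricType R}.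
Variable T : X -> X.

Let Y1 := unit_susp T.
Let pt1 : X -> R -> Y1 := susp_pt T unit_height.

Definition bw_horizontal (x y : X) (t : R) : R :=
  (1 - t) * mdist x y + t * mdist (T x) (T y).

Definition bw_vertical (p q : Y1) : R :=
  inf [set `|r| | r in [set r : R | susp_flow r p = q]].

(* bw_path p q l : some finite path of horizontal and vertical segments from p
   to q has length l. *)
Inductive bw_path : Y1 -> Y1 -> R -> Prop :=
| bw_path_nil p : bw_path p p 0
| bw_path_horizontal (x y : X) (t : R) (q : Y1) (l : R) : 0 <= t <= 1 ->
    bw_path (pt1 y t) q l -> bw_path (pt1 x t) q (bw_horizontal x y t + l)
| bw_path_vertical (p p' q : Y1) (l : R) : (exists r : R, susp_flow r p = p') ->
    bw_path p' q l -> bw_path p q (bw_vertical p p' + l).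

Definition bw_dist1 (p q : Y1) : R := inf [set l | bw_path p q l].

Variable phi : X -> {posnum R}.

Definition susp_rescale (y : susp_space T phi) : Y1 :=
  let p := val (repr y) in pt1 p.1 (p.2 / (phi p.1)%:num).

(* The choice of representatives is irrelevant: (u, phi u) and (T u, 0) are
   rescaled to (u, 1) and (T u, 0), which are the same point of Y1. *)
Definition bw_dist (y z : susp_space T phi) : R :=
  bw_dist1 (susp_rescale y) (susp_rescale z).

End bowen_walters.

(* Main.v *)
Require Import Defs.
From Stdlib Require Import Relation_Operators.
From mathcomp Require Import all_boot all_order all_algebra.
From mathcomp Require Import all_classical all_reals all_analysis.
From mathcomp Require Import lra ring.
Import Order.TTheory GRing.Theory Num.Theory.
Import numFieldNormedType.Exports.

(* Lifting a short Bowen-Walters path to X * R, where the flow is a translation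
   and the identification is (x, s) ~ (T x, s - 1), shows that locally the
   Bowen-Walters distance is bi-Lipschitz to d(x, y) + |s - t|, up to replacing
   x by T x or T^-1 x.  By invariance of mu these replacements do not matter, so
   the correlation integral of nu at scale r lies between constant multiples of
   r times that of mu at scales comparable to r; the factor r adds 1 to the
   exponent.  The formula for nu only speaks of continuous functions: balls are
   replaced by tent functions, and since the integral of a nonnegative function
   is monotone without measurability, fibre integrals need no regularity. *)

Local Open Scope classical_set_scope.
Local Open Scope ring_scope.

Set Implicit Arguments.
Unset Strict Implicit.
Unset Printing Implicit Defensive.

(** * Orbits and the covering of the height-one suspension by [X * R] *)

Section unit_orbit.
Context {R : realType} {X : pmetricType R} (T : X -> X).

(** The first obstacle is the metric: [bw_dist1] is an infimum over paths with arbitrarily many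
    segments, each measured at its own level and over its own base points. Composing Lipschitz
    estimates along a path would multiply constants without bound. On the lifted path every
    horizontal segment is compared with the base distance only once, and a short path stays within
    boundedly many levels, so the total loss is a fixed power of [L]; the pieces add up by the
    triangle inequality. The second obstacle is that the correlation integral of [nu] is a double
    integral whose inner part, the measure of a ball, need not be continuous in the centre. The
    tents are Lipschitz in both arguments, so averaging over one of them leaves a continuous
    function of the other, and the formula for [nu] applies a second time. Crossings of the roof
    matter only for the upper bound. For the lower bound it is enough to keep points low in their
    fibres, where a short vertical interval fits into every fibre. *)

Definition same_orbit (p q : X * R) := exists m n : nat,
  iter m T p.1 = iter n T q.1 /\ p.2 + n%:R = q.2 + m%:R.

Lemma same_orbit_refl p : same_orbit p p.
Proof. by exists 0%N, 0%N. Qed.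

Lemma same_orbit_sym p q : same_orbit p q -> same_orbit q p.
Proof. by move=> [m [n [mn e]]]; exists n, m. Qed.

Lemma same_orbit_trans p q r :
  same_orbit p q -> same_orbit q r -> same_orbit p r.
Proof.
move=> [m [n [mn e]]] [a [b [ab e']]]; exists (a + m)%N, (b + n)%N; split.
  by rewrite iterD mn -iterD addnC iterD ab -iterD addnC.
by rewrite !natrD; lra.
Qed.

Lemma same_orbit_shift p q r :
  same_orbit p q <-> same_orbit (p.1, p.2 + r) (q.1, q.2 + r).
Proof.
by split=> -[m [n [/= mn e]]]; exists m, n; split=> //=; lra.
Qed.

Lemma susp_orbit_eqP p q :
  susp_orbit_eq T unit_height p q <-> same_orbit p q.
Proof.
split=> [|[m [n [mn e]]]].
  elim=> {p q} [p q -> /=|p|p q _|p q r _ pq _].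
  - by exists 1%N, 0%N; split => //=; lra.
  - exact: same_orbit_refl.
  - exact: same_orbit_sym.
  - exact: same_orbit_trans.
have iterP k u : susp_orbit_eq T unit_height u (iter k T u.1, u.2 - k%:R).
  elim: k => [|k IH]; first by rewrite subr0; case: u => ? ?; exact: rst_refl.
  apply: rst_trans IH _; apply: rst_step => /=.
  by rewrite -natr1 opprD addrA.
apply: rst_trans (iterP m p) _; apply: rst_sym.
have := iterP n q; rewrite -mn.
by have -> : q.2 - n%:R = p.2 - m%:R by lra.
Qed.

Hypothesis injT : injective T.

Lemma iter_inj_le (m n : nat) (x y : X) : (m <= n)%N ->
  iter m T x = iter n T y -> x = iter (n - m) T y.
Proof.
move=> mn e; have : iter m T x = iter m T (iter (n - m) T y).
  by rewrite -iterD subnKC.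
by move: (iter (n - m) T y) => z; elim: m {mn e} => //= m IH /injT.
Qed.

(** Injectivity cancels the common iterates, so one point is a forward iterate of the other and the
    level gap counts the iterations. *)
Lemma same_orbit_cases p q : same_orbit p q ->
  exists n : nat, (q.1 = iter n T p.1 /\ p.2 = q.2 + n%:R) \/
                  (p.1 = iter n T q.1 /\ q.2 = p.2 + n%:R).
Proof.
move=> [m [n [mn e]]]; case: (leqP m n) => le_mn.
  exists (n - m)%N; right; split; first exact: iter_inj_le.
  by rewrite natrB//; lra.
exists (m - n)%N; left; split.
  by apply: iter_inj_le; [exact: ltnW|].
by rewrite natrB ?(ltnW le_mn)//; lra.
Qed.

(** Both levels lie in [0, 1], so the gap n is 0 (equal pairs), 1 (a roof point glued to the floor
    over its image) or impossible. *)
Lemma susp_glue_unitP (p q : susp_dom (@unit_height R X)) :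
  susp_glue T p q <-> same_orbit (val p) (val q).
Proof.
split.
  elim=> {p q} [p q [/= e1 e2]|p|p q _|p q r _ pq _].
  - by exists 1%N, 0%N; rewrite e1 e2 /=; split => //; lra.
  - exact: same_orbit_refl.
  - exact: same_orbit_sym.
  - exact: same_orbit_trans.
have main (u v : susp_dom (@unit_height R X)) n :
    (val v).1 = iter n T (val u).1 -> (val u).2 = (val v).2 + n%:R ->
    susp_glue T u v.
  move: (set_valP u) (set_valP v); rewrite /susp_dom /= => /andP[u0 u1] /andP[v0 v1].
  case: n => [|[|n]] e1 e2.
  - suff -> : u = v by exact: rst_refl.
    apply: val_inj; move: e1 e2 => /=.
    case: (val u) (val v) => [a b] [a' b'] /= -> ->.
    by rewrite addr0.
  - apply: rst_step => /=.
    have v20 : (val v).2 = 0 by move: e2; rewrite /=; lra.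
    split; first by rewrite e2 v20 add0r.
    by move: e1 v20 => /=; case: (val v) => [a b] /= -> ->.
  - exfalso; move: e2; rewrite -[n.+2]addn2 natrD => e2.
    have : 0 <= n%:R :> R by [].
    by move: e2 u1 v0; rewrite /=; lra.
move=> /same_orbit_cases[n [[? ?]|[? ?]]]; first exact: (main _ _ n).
by apply: rst_sym; exact: (main _ _ n).
Qed.

Let Y1 := unit_susp T.
Let pt1 : X -> R -> Y1 := susp_pt T unit_height.

(** The graph of the covering projection of [X * R] onto [Y1]. A relation makes sense at all levels,
    whereas [pt1] is meaningful on [0, 1] only. *)
Definition lies_over (p : X * R) (y : Y1) := same_orbit p (val (repr y)).

Lemma lies_over_uniq p q (y z : Y1) : lies_over p y -> lies_over q z ->
  same_orbit p q <-> y = z.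
Proof.
move=> py qz; split=> [pq|yz]; last first.
  by subst z; apply: same_orbit_trans py _; exact: same_orbit_sym.
have /susp_glue_unitP yz : same_orbit (val (repr y)) (val (repr z)).
  apply: same_orbit_trans (same_orbit_sym py) _.
  exact: same_orbit_trans pq qz.
rewrite -[y]reprK -[z]reprK; apply/eqmodP; exact/asboolP.
Qed.

Lemma val_insubd_dom (phi : X -> {posnum R}) x t : 0 <= t <= (phi x)%:num ->
  val (insubd (susp_base phi) (x, t)) = (x, t).
Proof. by move=> tx; rewrite insubdK// inE. Qed.

Lemma lies_over_pt x t : 0 <= t <= 1 -> lies_over (x, t) (pt1 x t).
Proof.
move=> t01; rewrite /lies_over -(@val_insubd_dom unit_height)//.
apply/susp_glue_unitP; have /eqmodP/asboolP := reprK (pt1 x t).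
exact: rst_sym.
Qed.

Lemma unit_suspP (y : Y1) : exists x t, 0 <= t <= 1 /\ y = pt1 x t.
Proof.
exists (val (repr y)).1, (val (repr y)).2; split; first exact: (set_valP (repr y)).
rewrite -[LHS]reprK /pt1 /susp_pt; congr (\pi_ _)%qT.
by apply: val_inj; rewrite val_insubd_dom -?surjective_pairing//; exact: (set_valP (repr y)).
Qed.

Variable g : X -> X.
Hypothesis gK : cancel g T.

Lemma lies_over_ex p : exists y, lies_over p y.
Proof.
have iterK k x : iter k T (iter k g x) = x.
  by elim: k => // k IH; rewrite iterSr -[in RHS]IH /= gK.
have fl : 0 <= p.2 - (Num.floor p.2)%:~R <= 1.
  by have := floor_itv p.2; rewrite intrD; lra.
(* The integer part of the level tells how often to apply [T], or [g] if it is negative; the second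
   constructor stands for -(n + 1). *)
case E : (Num.floor p.2) fl => [n|n] fl.
  exists (pt1 (iter n T p.1) (p.2 - n%:R)).
  have {}fl : 0 <= p.2 - n%:R <= 1 by exact: fl.
  apply: same_orbit_trans (lies_over_pt _ fl).
  by exists n, 0%N; split => //=; lra.
exists (pt1 (iter n.+1 g p.1) (p.2 + n.+1%:R)).
have fl' : 0 <= p.2 + n.+1%:R <= 1 by move: fl; rewrite NegzE mulrNz opprK.
apply: same_orbit_trans (lies_over_pt _ fl').
by exists 0%N, n.+1; rewrite [in RHS]iterK; split => //; rewrite /= addr0.
Qed.

(** On lifts the flow is a translation. Surjectivity of [T] enters through [lies_over_ex]: the set
    behind [susp_flow] is inhabited, so [get] does not fall back on its default. *)
Lemma lies_over_flow p y r : lies_over p y ->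
  lies_over (p.1, p.2 + r) (susp_flow r y).
Proof.
move=> py; have [z] := lies_over_ex ((val (repr y)).1, (val (repr y)).2 + r).
move=> /susp_orbit_eqP yz.
have /susp_orbit_eqP := @getI _ [set z : Y1 | susp_orbit_eq T unit_height
  ((val (repr y)).1, (val (repr y)).2 + r) (val (repr z))] z yz.
by apply: same_orbit_trans; exact: ((same_orbit_shift _ _ r).1 py).
Qed.

End unit_orbit.

(** * The height-one distance and the lifting of paths *)

Section bw_dist1.
Context {R : realType} {X : pmetricType R} (T g : X -> X) (L : R).
Hypotheses (TK : cancel T g) (gK : cancel g T) (L1 : 1 <= L).
Hypothesis T_lip : forall x y, mdist (T x) (T y) <= L * mdist x y.
Hypothesis g_lip : forall x y, mdist (g x) (g y) <= L * mdist x y.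

Let pt1 : X -> R -> unit_susp T := susp_pt T unit_height.
Let injT : injective T := can_inj TK.
Let L0 : 0 < L := lt_le_trans ltr01 L1.

(** The length is a weighted mean of d(x, y) and d(Tx, Ty), and both are at least d(x, y) / L. *)
Lemma bw_horizontal_ge x y t : 0 <= t <= 1 ->
  mdist x y <= L * bw_horizontal T x y t.
Proof.
move=> /andP[t0 t1]; rewrite /bw_horizontal.
have := g_lip (T x) (T y); rewrite !TK; move: (mdist_ge0 x y).
move: (mdist x y) => a; move: (mdist _ _) => b a0 ab.
have : 0 <= (L - 1) * ((1 - t) * a).
  by apply: mulr_ge0; [rewrite subr_ge0|apply: mulr_ge0 => //; rewrite subr_ge0].
have : 0 <= t * (L * b - a) by rewrite mulr_ge0 ?subr_ge0.
nra.
Qed.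

Lemma bw_horizontal_le x y t : 0 <= t <= 1 ->
  bw_horizontal T x y t <= L * mdist x y.
Proof.
move=> /andP[t0 t1]; rewrite /bw_horizontal.
have := T_lip x y; move: (mdist_ge0 x y).
move: (mdist x y) => a; move: (mdist _ _) => b a0 ab.
have : 0 <= (L - 1) * ((1 - t) * a).
  by apply: mulr_ge0; [rewrite subr_ge0|apply: mulr_ge0 => //; rewrite subr_ge0].
have : 0 <= t * (L * a - b) by rewrite mulr_ge0 ?subr_ge0.
nra.
Qed.

Lemma bw_horizontal_ge0 x y t : 0 <= t <= 1 -> 0 <= bw_horizontal T x y t.
Proof.
move=> t01; have := bw_horizontal_ge x y t01.
by move=> /(le_trans (mdist_ge0 x y)); rewrite pmulr_rge0.
Qed.

Lemma bw_vertical_ge0 (p q : unit_susp T) : 0 <= bw_vertical p q.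
Proof.
rewrite /bw_vertical; set S := [set _ | _ in _].
(* Points on different orbits give an empty set, whose infimum is 0 by convention. *)
have [->|/set0P S0] := eqVneq S set0; first by rewrite inf0.
by apply: lb_le_inf => // _ [r _ <-].
Qed.

Lemma bw_path_ge0 (p q : unit_susp T) l : bw_path p q l -> 0 <= l.
Proof.
elim=> {p q l}[//|x y t q l t01 _ l0|p p' q l _ _ l0].
  by rewrite addr_ge0// bw_horizontal_ge0.
by rewrite addr_ge0// bw_vertical_ge0.
Qed.

Lemma bw_path_cat (p q r : unit_susp T) l l' :
  bw_path p q l -> bw_path q r l' -> bw_path p r (l + l').
Proof.
move=> pq qr; elim: pq qr => {p q l}[p|x y t q l t01 _ IH|p p' q l e _ IH] qr.
- by rewrite add0r.
- by rewrite -addrA; apply: bw_path_horizontal => //; exact: IH.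
- by rewrite -addrA; apply: bw_path_vertical e _; exact: IH.
Qed.

Lemma susp_flow_pt x t t' : 0 <= t <= 1 -> 0 <= t' <= 1 ->
  susp_flow (t' - t) (pt1 x t) = pt1 x t'.
Proof.
move=> t01 t'01.
have xt := lies_over_flow injT gK (t' - t) (lies_over_pt injT x t01).
apply/(lies_over_uniq injT xt (lies_over_pt injT x t'01)).
by rewrite /= addrC subrK; exact: same_orbit_refl.
Qed.

Lemma bw_path_pt x y t t' : 0 <= t <= 1 -> 0 <= t' <= 1 ->
  exists2 l, bw_path (pt1 x t) (pt1 y t') l &
    l <= bw_horizontal T x y t + `|t' - t|.
Proof.
move=> t01 t'01; have e := susp_flow_pt y t01 t'01.
exists (bw_horizontal T x y t + (bw_vertical (pt1 y t) (pt1 y t') + 0)).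
  apply: bw_path_horizontal => //; apply: bw_path_vertical; last exact: bw_path_nil.
  by exists (t' - t).
rewrite addr0 lerD2l; apply: ge_inf; last by exists (t' - t).
by exists 0 => _ [r _ <-].
Qed.

(** Keeps the infimum in [bw_dist1] away from the empty set, where it would be the default 0. *)
Lemma bw_path_ex (p q : unit_susp T) : exists l, bw_path p q l.
Proof.
have [x [t [t01 ->]]] := unit_suspP p; have [y [t' [t'01 ->]]] := unit_suspP q.
by have [l pq _] := bw_path_pt x y t01 t'01; exists l.
Qed.

Lemma bw_dist1_le (p q : unit_susp T) l : bw_path p q l -> bw_dist1 p q <= l.
Proof. by move=> pq; apply: ge_inf => //; exists 0 => r; exact: bw_path_ge0. Qed.

Lemma bw_dist1_triangle (q p r : unit_susp T) :
  bw_dist1 p r <= bw_dist1 p q + bw_dist1 q r.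
Proof.
rewrite -lerBlDl; have [l qr] := bw_path_ex q r.
apply: lb_le_inf; first by exists l.
move=> {l}l' {}qr; rewrite lerBlDl -lerBlDr; have [l pq] := bw_path_ex p q.
apply: lb_le_inf; first by exists l.
move=> {l}l {}pq; rewrite lerBlDr; apply: bw_dist1_le; exact: bw_path_cat pq qr.
Qed.

Lemma bw_dist1_pt_le x y t t' : 0 <= t <= 1 -> 0 <= t' <= 1 ->
  bw_dist1 (pt1 x t) (pt1 y t') <= L * mdist x y + `|t' - t|.
Proof.
move=> t01 t'01; have [l pq le_l] := bw_path_pt x y t01 t'01.
apply: le_trans (bw_dist1_le pq) _; apply: le_trans le_l _.
by rewrite lerD2r bw_horizontal_le.
Qed.

Lemma mdist_iter (f : X -> X) n x y :
  (forall u v, mdist (f u) (f v) <= L * mdist u v) -> (n <= 2)%N ->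
  mdist (iter n f x) (iter n f y) <= L ^+ 2 * mdist x y.
Proof.
move=> f_lip n2; apply: (@le_trans _ _ (L ^+ n * mdist x y)).
  elim: n {n2} => [|n IH]; first by rewrite mul1r.
  by rewrite exprS -mulrA; apply: le_trans (f_lip _ _) _; rewrite ler_pM2l.
by apply: ler_wpM2r; [exact: mdist_ge0|exact: ler_weXn2l].
Qed.

(** The levels s and t differ by an integer of size at most 2, so at most two applications of [T] or
    of [g] carry the segment to level s. *)
Lemma lift_horizontal x s x0 y0 t : -1 <= s <= 2 -> 0 <= t <= 1 ->
  same_orbit T (x, s) (x0, t) ->
  exists2 y, same_orbit T (y, s) (y0, t) & mdist x y <= L ^+ 2 * mdist x0 y0.
Proof.
move=> s12 t01 /(same_orbit_cases injT)[n /= [[e1 e2]|[e1 e2]]].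
- have n2 : (n <= 2)%N by rewrite -(ler_nat R); lra.
  exists (iter n g y0).
    exists n, 0%N => /=; split; last by rewrite addr0.
    by elim: n {e1 e2 n2} => // n IH; rewrite iterSr /= gK.
  have -> : x = iter n g x0.
    by rewrite e1; elim: n {e1 e2 n2} => // n IH; rewrite iterSr /= TK.
  exact: mdist_iter.
- have n2 : (n <= 2)%N by rewrite -(ler_nat R); lra.
  exists (iter n T y0); last by rewrite e1; exact: mdist_iter.
  by exists 0%N, n => /=; split => //; rewrite addr0.
Qed.

(* The bounds on s - l' and s + l' keep the lifted path in three consecutive unit
   levels, where lifting distorts horizontal distances by at most L ^+ 2. *)
Lemma bw_path_lift (p q : unit_susp T) l : bw_path p q l ->
  forall x s l', lies_over (x, s) p -> l < l' -> -1 <= s - l' -> s + l' <= 2 ->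
  exists y s', [/\ lies_over (y, s') q, `|s' - s| <= l' &
                  mdist x y <= L ^+ 3 * l'].
Proof.
elim=> {p q l}[p|x0 y0 t q l t01 pq IH|p p' q l [r0 r0p] pq IH] x s l' xp ll' s1 s2.
- exists x, s; split => //; first by rewrite subrr normr0 ltW.
  by rewrite mdistxx mulr_ge0 ?ltW// exprn_gt0.
- have l0 := bw_path_ge0 pq; have h0 := bw_horizontal_ge0 x0 y0 t01.
  have s12 : -1 <= s <= 2 by lra.
  have /(lift_horizontal y0 s12 t01)[y xy dxy] : same_orbit T (x, s) (x0, t).
    by apply/(lies_over_uniq injT xp (lies_over_pt injT x0 t01)).
  have /IH : lies_over (y, s) (pt1 y0 t).
    exact: same_orbit_trans xy (lies_over_pt injT y0 t01).
  set h := bw_horizontal T x0 y0 t in ll' h0 *.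
  case/(_ (l' - h)); [lra|lra|lra|] => z [s' [zq s's dyz]].
  exists z, s'; split => //; first by lra.
  apply: le_trans (metric_triangle x y _) _.
  (* [L ^+ 2] for moving the segment to level s, one more [L] for comparing its length with the base
     distance. *)
  have : mdist x y <= L ^+ 3 * h.
    apply: le_trans dxy _; rewrite [L ^+ 3]exprSr -mulrA ler_wpM2l//.
      by rewrite exprn_ge0// ltW.
    exact: bw_horizontal_ge.
  by rewrite mulrBr in dyz; lra.
- have l0 := bw_path_ge0 pq.
  (* The vertical length is an infimum; the slack between l and l' pays for an actual flow time r
     close to it. *)
  have : bw_vertical p p' < l' - l by lra.
  case/inf_lt; first by exists `|r0|, r0.
  move=> _ [r /= rp <-] rl.
  have /IH : lies_over (x, s + r) p' by rewrite -rp; exact: (lies_over_flow injT gK r xp).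
  have r1 := ler_norm r; have r2 := ler_norm (- r); rewrite normrN in r2.
  case/(_ (l' - `|r|)); [lra|lra|lra|] => z [s' [zq s's dyz]].
  exists z, s'; split => //.
    have -> : s' - s = s' - (s + r) + r by ring.
    by apply: le_trans (ler_normD _ _) _; lra.
  by apply: le_trans dyz _; rewrite ler_pM2l ?exprn_gt0//; lra.
Qed.

(** The lifted endpoint has a level within l of t, hence at distance at most 3/2 from t', and the
    gap is an integer: 0 or 1 in either direction. A gap of 1 forces t' close to the floor or to the
    roof; shifting by [T] in that case costs the fourth factor [L]. *)
Lemma bw_dist1_pt_lt x t y t' l : 0 <= t <= 1 -> 0 <= t' <= 1 -> l <= 2^-1 ->
  bw_dist1 (pt1 x t) (pt1 y t') < l ->
  [\/ mdist x y <= L ^+ 4 * l /\ `|t' - t| <= l,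
      mdist (T x) y <= L ^+ 4 * l /\ t' <= l |
      mdist x (T y) <= L ^+ 4 * l /\ 1 - l <= t'].
Proof.
move=> t01 t'01 l2 pl.
have [l0 pq l0l] : exists2 l0, bw_path (pt1 x t) (pt1 y t') l0 & l0 < l.
  by apply: inf_lt pl; have [k ?] := bw_path_ex (pt1 x t) (pt1 y t'); exists k.
have l_gt0 : 0 < l := le_lt_trans (bw_path_ge0 pq) l0l.
have [||z [s [zq st dxz]]] := bw_path_lift pq (lies_over_pt injT x t01) l0l.
- by lra.
- by lra.
have L34 : L ^+ 3 * l <= L ^+ 4 * l by rewrite ler_pM2r// ler_weXn2l.
have := (lies_over_uniq injT zq (lies_over_pt injT y t'01)).2 erefl.
have s1 := ler_norm (s - t); have s2 := ler_norm (- (s - t)); rewrite normrN in s2.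
have n2 n : 2 <= n.+2%:R :> R by rewrite (ler_nat R 2).
move=> /(same_orbit_cases injT)[[|[|n]] /= [[e1 e2]|[e1 e2]]]; try (have := n2 n; lra).
- rewrite addr0 in e2; apply: Or31; rewrite e1 -e2; split => //; lra.
- rewrite addr0 in e2; apply: Or31; rewrite -e1 e2; split => //; lra.
- apply: Or32; split; last by lra.
  rewrite e1 [L ^+ 4]exprS -mulrA; apply: le_trans (T_lip _ _) _.
  by rewrite ler_pM2l.
- apply: Or33; split; last by lra.
  by rewrite -e1; exact: le_trans dxz L34.
Qed.

End bw_dist1.

(** * Continuity on the suspension space *)

Section susp_lipschitz.
Context {R : realType} {X : pmetricType R} (T : X -> X) (phi : X -> {posnum R}).

Lemma susp_pt_repr (p : susp_dom phi) :
  \pi_(susp_space T phi)%qT p = susp_pt T phi (val p).1 (val p).2.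
Proof.
congr (\pi_ _)%qT; apply: val_inj.
by rewrite val_insubd_dom -?surjective_pairing//; exact: (set_valP p).
Qed.

(** A Lipschitz bound in the coordinates before gluing. One-sided, since exchanging the two points
    gives the other side. *)
Definition susp_lip (c : R) (f : susp_space T phi -> R) :=
  forall x s y t, 0 <= s <= (phi x)%:num -> 0 <= t <= (phi y)%:num ->
    f (susp_pt T phi x s) - f (susp_pt T phi y t) <= c * (mdist x y + `|t - s|).

(** Continuity on a quotient is continuity of the composite with the projection, so only the product
    topology on [susp_dom] matters, and no metric on the quotient. *)
Lemma continuous_susp c (f : susp_space T phi -> R) : susp_lip c f -> continuous f.
Proof.
move=> f_lip; apply/quotient_continuous => p.
have f_pi q : f (\pi_(susp_space T phi)%qT q) = f (susp_pt T phi (val q).1 (val q).2).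
  by rewrite susp_pt_repr.
apply/(@cvgrPdist_le _ _ _ _ (nbhs_filter p)) => e e0.
(* The 2 shares e between the two coordinates; adding 1 to the absolute value covers c = 0. *)
have c0 : 0 < 2 * (`|c| + 1) by have := normr_ge0 c; lra.
have d0 : 0 < e / (2 * (`|c| + 1)) by rewrite divr_gt0.
have near_q : \forall q \near p, ball (val p) (e / (2 * (`|c| + 1))) (val q).
  exact: (@initial_continuous _ _ (set_val : susp_dom phi -> X * R) p _
           (nbhsx_ballx (val p) _ d0)).
apply: (@filterS _ _ (nbhs_filter p) _ _ _ near_q) => q [/= d1 d2].
rewrite ballEmdist /= in d1; rewrite /ball /= in d2.
have hp : 0 <= (val p).2 <= (phi (val p).1)%:num := set_valP p.
have hq : 0 <= (val q).2 <= (phi (val q).1)%:num := set_valP q.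
rewrite (f_pi p) (f_pi q).
have h1 := f_lip _ _ _ _ hp hq; have h2 := f_lip _ _ _ _ hq hp.
rewrite metric_sym in h2; rewrite distrC in h1.
rewrite /= in h1 h2 d1 d2 *.
set a := mdist _ _ in h1 h2 d1; set b := `|_ - _| in h1 h2 d2.
have : c * (a + b) <= e.
  have le_c : c <= `|c| + 1 by have := ler_norm c; lra.
  have ab0 : 0 <= a + b by rewrite addr_ge0 ?mdist_ge0 ?normr_ge0.
  apply: le_trans (ler_wpM2r ab0 le_c) _.
  have c1 : 0 < `|c| + 1 by lra.
  rewrite mulrC -ler_pdivlMr//.
  have : e / (2 * (`|c| + 1)) = (e / (`|c| + 1)) / 2.
    by rewrite invfM mulrA mulrAC.
  by lra.
by move: h1 h2; rewrite ler_norml; lra.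
Qed.

End susp_lipschitz.

(** * The distance for a general height function, and tents *)

Section bw_dist.
Context {R : realType} {X : pmetricType R} (T g : X -> X) (phi : X -> {posnum R}).
Variables (L K m : R).
Hypotheses (TK : cancel T g) (gK : cancel g T) (L1 : 1 <= L).
Hypothesis T_lip : forall x y, mdist (T x) (T y) <= L * mdist x y.
Hypothesis g_lip : forall x y, mdist (g x) (g y) <= L * mdist x y.
Hypothesis phi_lip : forall x y, (phi x)%:num - (phi y)%:num <= K * mdist x y.
Hypotheses (K0 : 0 <= K) (m0 : 0 < m) (m_le : forall x, m <= (phi x)%:num).

Let pt := susp_pt T phi.
Let pt1 : X -> R -> unit_susp T := susp_pt T unit_height.
Let D := bw_dist (T := T) (phi := phi).
Let injT : injective T := can_inj TK.

Lemma div_height01 x s : 0 <= s <= (phi x)%:num -> 0 <= s / (phi x)%:num <= 1.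
Proof. by move=> /andP[s0 s1]; rewrite divr_ge0//= ler_pdivrMr// mul1r. Qed.

Lemma susp_rescale_pt x s : 0 <= s <= (phi x)%:num ->
  susp_rescale (pt x s) = pt1 x (s / (phi x)%:num).
Proof.
move=> sx; pose F (p : susp_dom phi) := pt1 (val p).1 ((val p).2 / (phi (val p).1)%:num).
suff glueF p q : susp_glue T p q -> F p = F q.
  transitivity (F (insubd (susp_base phi) (x, s))); last by rewrite /F val_insubd_dom.
  apply: glueF; have /eqmodP/asboolP := reprK (pt x s); exact.
elim=> {p q} [p q [e1 e2]|//|p q _ -> //|p q r _ -> _ -> //].
rewrite /F e1 e2 /= mul0r divff//.
apply/(lies_over_uniq injT (lies_over_pt injT _ _) (lies_over_pt injT _ _)) => //.
- by rewrite ler01 lexx.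
- by rewrite ler01 lexx.
- by exists 1%N, 0%N; split => //=; rewrite addr0 add0r.
Qed.

(** [L] accounts for the horizontal distance, the fraction for the change of the normalised level s
    / phi x. *)
Definition bw_lip_const := L + (1 + K) / m.

Lemma bw_lip_const_gt0 : 0 < bw_lip_const.
Proof.
apply: addr_gt0; first exact: lt_le_trans ltr01 L1.
by apply: divr_gt0 => //; move: K0; lra.
Qed.

Lemma div_height_lip x s y t :
  0 <= s <= (phi x)%:num -> 0 <= t <= (phi y)%:num ->
  `|t / (phi y)%:num - s / (phi x)%:num| <= (1 + K) / m * (mdist x y + `|t - s|).
Proof.
move=> sx ty.
(* This splitting keeps t / phi y, a number in [0, 1], as a factor, so that only one division by a
   height has to be estimated. *)
have -> : t / (phi y)%:num - s / (phi x)%:num = (t - s) / (phi x)%:num +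
   t / (phi y)%:num * (((phi x)%:num - (phi y)%:num) / (phi x)%:num).
  by field; rewrite !gt_eqF.
apply: le_trans (ler_normD _ _) _.
have u01 := div_height01 ty; set u := t / _ in u01 *.
have phi_inv : `|(phi x)%:num^-1| <= m^-1.
  by rewrite normfV ger0_norm// lef_pV2 ?posrE.
have h1 : `|(t - s) / (phi x)%:num| <= `|t - s| / m.
  by rewrite normrM ler_wpM2l.
have h2 : `|(phi x)%:num - (phi y)%:num| <= K * mdist x y.
  by have := phi_lip x y; have := phi_lip y x; rewrite metric_sym ler_norml; lra.
have h3 : `|u * (((phi x)%:num - (phi y)%:num) / (phi x)%:num)| <= K * mdist x y / m.
  rewrite normrM (ger0_norm (proj1 (andP u01))).
  apply: (@le_trans _ _ `|((phi x)%:num - (phi y)%:num) / (phi x)%:num|).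
    by rewrite ler_piMl//; case/andP: u01.
  by rewrite normrM ler_pM.
apply: le_trans (lerD h1 h3) _; rewrite -mulrDl mulrAC ler_wpM2r ?invr_ge0 ?(ltW m0)//.
have := mulr_ge0 K0 (normr_ge0 (t - s)); have := mdist_ge0 x y.
by rewrite mulrDl mul1r mulrDr; lra.
Qed.

Lemma bw_dist_triangle y z w : D y w <= D y z + D z w.
Proof. exact: (bw_dist1_triangle TK gK L1 g_lip). Qed.

Lemma bw_dist_pt_le x s y t : 0 <= s <= (phi x)%:num -> 0 <= t <= (phi y)%:num ->
  D (pt x s) (pt y t) <= bw_lip_const * (mdist x y + `|t - s|).
Proof.
move=> sx ty; rewrite /D /bw_dist !susp_rescale_pt//.
have := bw_dist1_pt_le TK gK L1 T_lip g_lip x y (div_height01 sx) (div_height01 ty).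
move=> /le_trans; apply.
rewrite /bw_lip_const mulrDl lerD ?div_height_lip//.
by rewrite ler_wpM2l ?lerDl// (le_trans ler01).
Qed.

Lemma bw_dist_pt_lt x s y t l : 0 <= s <= (phi x)%:num -> 0 <= t <= (phi y)%:num ->
  l <= 2^-1 -> D (pt x s) (pt y t) < l ->
  [\/ mdist x y <= L ^+ 4 * l /\
        `|t / (phi y)%:num - s / (phi x)%:num| <= l,
      mdist (T x) y <= L ^+ 4 * l /\ t / (phi y)%:num <= l |
      mdist x (T y) <= L ^+ 4 * l /\ 1 - l <= t / (phi y)%:num].
Proof.
move=> sx ty l2; rewrite /D /bw_dist !susp_rescale_pt//.
exact: (bw_dist1_pt_lt TK gK L1 T_lip g_lip (div_height01 sx) (div_height01 ty)).
Qed.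

(** Lies between the indicators of the balls of radii r and 2 r about y. *)
Definition tent (r : R) (y z : susp_space T phi) : R :=
  Num.max 0 (Num.min 1 (2 - D y z / r)).

Lemma tent01 r y z : 0 <= tent r y z <= 1.
Proof.
by rewrite /tent le_max lexx /= ge_max ler01 /= ge_min lexx.
Qed.

Lemma tent_eq1 r y z : 0 < r -> D y z < r -> tent r y z = 1.
Proof.
move=> r0 yz; have : D y z / r < 1 by rewrite ltr_pdivrMr// mul1r.
by rewrite /tent => ?; rewrite (min_idPl _) ?(max_idPr _)//; lra.
Qed.

Lemma tent_eq0 r y z : 0 < r -> 2 * r <= D y z -> tent r y z = 0.
Proof.
move=> r0 yz; have : 2 <= D y z / r by rewrite ler_pdivlMr.
by rewrite /tent => ?; rewrite (min_idPr _) ?(max_idPl _)//; lra.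
Qed.

Let tent_le r y z y' z' e : 0 < r -> D y' z' <= D y z + e * r -> 0 <= e ->
  tent r y z - tent r y' z' <= e.
Proof.
move=> r0 h e0; have : D y' z' / r <= D y z / r + e.
  by rewrite ler_pdivrMr// mulrDl divfK// gt_eqF.
rewrite /tent lerBlDr => h'; rewrite ge_max; apply/andP; split.
  by rewrite addr_ge0// le_max lexx.
apply: (@le_trans _ _ (e + Num.min 1 (2 - D y' z' / r))); last first.
  by rewrite lerD2l le_max lexx orbT.
rewrite -lerBlDl le_min !lerBlDl !ge_min; apply/andP; split.
  by apply/orP; left; lra.
by apply/orP; right; lra.
Qed.

Lemma tent_lipr r y : 0 < r -> susp_lip (bw_lip_const / r) (tent r y).
Proof.
move=> r0 x s x' s' sx sx'; apply: tent_le => //; last first.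
  apply: mulr_ge0; last by rewrite addr_ge0 ?mdist_ge0.
  by apply: divr_ge0; apply: ltW => //; exact: bw_lip_const_gt0.
apply: le_trans (bw_dist_triangle _ (pt x s) _) _; rewrite lerD2l.
apply: le_trans (bw_dist_pt_le sx sx') _.
by rewrite mulrAC divfK// gt_eqF.
Qed.

Lemma tent_lipl r z : 0 < r -> susp_lip (bw_lip_const / r) (tent r ^~ z).
Proof.
move=> r0 x s x' s' sx sx'; apply: tent_le => //; last first.
  apply: mulr_ge0; last by rewrite addr_ge0 ?mdist_ge0.
  by apply: divr_ge0; apply: ltW => //; exact: bw_lip_const_gt0.
apply: le_trans (bw_dist_triangle _ (pt x s) _) _; rewrite addrC lerD2l.
apply: le_trans (bw_dist_pt_le sx' sx) _.
by rewrite metric_sym distrC mulrAC divfK// gt_eqF.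
Qed.

Lemma bw_lip y : susp_lip bw_lip_const (D y).
Proof.
move=> x s x' s' sx sx'; rewrite lerBlDr.
apply: le_trans (bw_dist_triangle _ (pt x' s') _) _; rewrite addrC lerD2r.
by apply: le_trans (bw_dist_pt_le sx' sx) _; rewrite metric_sym distrC.
Qed.

End bw_dist.

(** * Integrals of nonnegative functions without measurability *)

Section lower_integral.
Context d (T : measurableType d) (R : realType) (mu : {measure set T -> \bar R}).
Import HBNNSimple.
Local Open Scope ereal_scope.

Lemma integral_mono (D : set T) (f g : T -> \bar R) :
  (forall x, D x -> 0 <= f x) -> (forall x, D x -> f x <= g x) ->
  \int[mu]_(x in D) f x <= \int[mu]_(x in D) g x.
Proof.
move=> f0 fg; have g0 x : D x -> 0 <= g x by move=> Dx; exact: le_trans (f0 _ Dx) (fg _ Dx).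
rewrite !ge0_integralE//; apply: ge_ereal_sup => _ [h /= hf <-].
apply: ereal_sup_ubound; exists h => //= x; apply: le_trans (hf x) _.
by rewrite !patchE; case: ifP => // /set_mem; exact: fg.
Qed.

(** Dividing by c turns a simple function below c f into one below f. The converse inequality is the
    same statement for the inverse of c. *)
Lemma integralZ_le (f : T -> \bar R) (c : R) : (forall x, 0 <= f x) -> (0 < c)%R ->
  \int[mu]_x (c%:E * f x) <= c%:E * \int[mu]_x f x.
Proof.
move=> f0 c0; rewrite !ge0_integralTE//; last first.
  by move=> x; rewrite mule_ge0// lee_fin ltW.
apply: ge_ereal_sup => _ [h /= hf <-].
have ci0 : (0 <= c^-1)%R by rewrite invr_ge0 ltW.
have : sintegral mu (scale_nnsfun h ci0) <= ereal_sup [set sintegral mu h0 | h0 in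
    [set h0 : {nnsfun T >-> R} | forall x, (h0 x)%:E <= f x]].
  apply: ereal_sup_ubound; exists (scale_nnsfun h ci0) => //= x.
  by rewrite EFinM muleC lee_pdivrMr// muleC.
have -> : sintegral mu (scale_nnsfun h ci0) = (c^-1)%:E * sintegral mu h.
  exact: sintegralrM.
by rewrite muleC lee_pdivrMr// muleC.
Qed.

Lemma integralZ (f : T -> \bar R) (c : R) : (forall x, 0 <= f x) -> (0 < c)%R ->
  \int[mu]_x (c%:E * f x) = c%:E * \int[mu]_x f x.
Proof.
move=> f0 c0; apply/eqP; rewrite eq_le integralZ_le//=.
have cf0 x : 0 <= c%:E * f x by rewrite mule_ge0// lee_fin ltW.
have := integralZ_le cf0 (_ : (0 < c^-1)%R); rewrite invr_gt0 => /(_ c0).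
under eq_integral do rewrite muleA -EFinM mulVf ?gt_eqF// mul1e.
by rewrite [X in _ <= X]muleC lee_pdivlMr// muleC.
Qed.

(** The real-valued integral sends an infinite value to 0; the bound [B] on a set of finite measure
    excludes this. *)
Lemma Rintegral_bounded (D : set T) (f : T -> R) (B : R) :
  measurable D -> mu D < +oo -> (forall x, D x -> (0 <= f x <= B)%R) ->
  \int[mu]_(x in D) (f x)%:E = (\int[mu]_(x in D) f x)%R%:E.
Proof.
move=> mD muD fB; rewrite fineK// ge0_fin_numE; last first.
  by apply: integral_ge0 => x /fB /andP[? _]; rewrite lee_fin.
apply: (@le_lt_trans _ _ (\int[mu]_(x in D) B%:E)).
  by apply: integral_mono => x /fB /andP[? ?]; rewrite lee_fin.
have muD_fin : mu D \is a fin_num by rewrite ge0_fin_numE.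
by rewrite integral_cst// -(fineK muD_fin) -EFinM ltry.
Qed.

End lower_integral.

Lemma Rintegral_mono d (T : measurableType d) (R : realType)
    (mu : {measure set T -> \bar R}) (D : set T) (f g : T -> R) (B : R) :
  measurable D -> (mu D < +oo)%E ->
  (forall x, D x -> 0 <= f x <= g x) -> (forall x, D x -> g x <= B) ->
  \int[mu]_(x in D) f x <= \int[mu]_(x in D) g x.
Proof.
move=> mD muD fg gB.
have f0 x : D x -> 0 <= f x by move=> /fg /andP[].
have g0 x : D x -> 0 <= g x by move=> /fg /andP[a b]; exact: le_trans b.
rewrite -lee_fin -(@Rintegral_bounded _ _ _ _ _ f B)//; last first.
  by move=> x Dx; rewrite f0//= (le_trans _ (gB x Dx))//; have /andP[] := fg x Dx.
rewrite -(@Rintegral_bounded _ _ _ _ _ g B)//; last first.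
  by move=> x Dx; rewrite g0//= gB.
by apply: integral_mono => x Dx; rewrite lee_fin ?f0//; have /andP[] := fg x Dx.
Qed.

Lemma measurable_borel_open (Y : ptopologicalType) (A : set Y) :
  open A -> measurable (A : set (borel Y)).
Proof. by move=> oA; exact: sub_sigma_algebra. Qed.

Lemma measurable_borel_fun (R : realType) (Y : ptopologicalType) (f : Y -> R) :
  continuous f -> measurable_fun [set: borel Y] (f : borel Y -> R).
Proof.
move=> /continuousP cf; apply: (measurability _ (measurable_realfun.RGenOpens.measurableE R)).
move=> _ [_ [a [b ->]] <-]; rewrite setTI.
by apply: measurable_borel_open; apply: cf; exact: interval_open.
Qed.

Lemma probability_setT_lty d (T : measurableType d) (R : realType)
  (P : probability T R) : (P [set: T] < +oo)%E.
Proof. by rewrite probability_setT ltry. Qed.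

(** * Estimating integrals against [nu] fibre by fibre *)

Section suspension_measure.
Context {R : realType} {X : pmetricType R} (T : X -> X) (phi : X -> {posnum R}).
Context (mu : probability (borel X) R) (nu : probability (borel (susp_space T phi)) R).
Variables m M : R.
Hypotheses (m0 : 0 < m) (phi_bounded : forall x, m <= (phi x)%:num <= M).
Hypothesis nuE : is_suspension_measure mu nu.

Let pt := susp_pt T phi.
Let I := \int[mu]_x (phi x)%:num.

Lemma mean_height_gt0 : 0 < I.
Proof.
apply: lt_le_trans m0 _; have -> : m = \int[mu]_(_ in setT) m.
  by rewrite Rintegral_cst// (_ : fine _ = 1) ?mulr1// [X in fine X](probability_setT mu).
apply: (@Rintegral_mono _ _ _ _ _ _ _ M) => //.
- exact: probability_setT_lty.
- by move=> x _; rewrite (ltW m0); case/andP: (phi_bounded x).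
- by move=> x _; case/andP: (phi_bounded x).
Qed.

Let inner (f : susp_space T phi -> R) x :=
  \int[lebesgue_measure]_(s in `[0, (phi x)%:num]) f (pt x s).

Lemma lebesgue_fibre x :
  lebesgue_measure `[0%R, (phi x)%:num] = (phi x)%:num%:E :> \bar R.
Proof. by rewrite lebesgue_measure_itv/= lte_fin ifT// oppr0 adde0. Qed.

Let innerE (f : susp_space T phi -> R) x : (forall y, 0 <= f y <= 1) ->
  (\int[lebesgue_measure]_(s in `[0%R, (phi x)%:num]) (f (pt x s))%:E)%E = (inner f x)%:E.
Proof.
move=> f01; apply: (@Rintegral_bounded _ _ _ _ _ _ 1) => //.
by rewrite /= lebesgue_fibre ltry.
Qed.

Lemma susp_integral_le (f : susp_space T phi -> R) (h : X -> R) (B : R) :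
  continuous f -> (forall y, 0 <= f y <= 1) -> (forall x, h x <= B) ->
  (forall x, (\int[lebesgue_measure]_(s in `[0%R, (phi x)%:num]) (f (pt x s))%:E
    <= (h x)%:E)%E) ->
  \int[nu]_y f y <= I^-1 * \int[mu]_x h x.
Proof.
move=> cf f01 hB fh; rewrite nuE// mulrC ler_wpM2l ?invr_ge0 ?(ltW mean_height_gt0)//.
apply: (@Rintegral_mono _ _ _ _ _ _ _ B) => //.
  exact: probability_setT_lty.
move=> x _; rewrite -!lee_fin -(innerE x f01) fh andbT.
by apply: integral_ge0 => s _; rewrite lee_fin; case/andP: (f01 (pt x s)).
Qed.

Lemma susp_integral_ge (f : susp_space T phi -> R) (h : X -> R) :
  continuous f -> (forall y, 0 <= f y <= 1) -> (forall x, 0 <= h x) ->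
  (forall x, ((h x)%:E <=
    \int[lebesgue_measure]_(s in `[0%R, (phi x)%:num]) (f (pt x s))%:E)%E) ->
  I^-1 * \int[mu]_x h x <= \int[nu]_y f y.
Proof.
move=> cf f01 h0 fh; rewrite nuE// mulrC ler_wpM2r ?invr_ge0 ?(ltW mean_height_gt0)//.
(* As f <= 1, a fibre integral is at most the length of the fibre, hence at most [M]. *)
apply: (@Rintegral_mono _ _ _ _ _ _ _ M) => //.
- exact: probability_setT_lty.
- by move=> x _; rewrite h0 /= -lee_fin -(innerE x f01); exact: fh.
move=> x _; rewrite -lee_fin -(innerE x f01).
apply: (@le_trans _ _ (\int[lebesgue_measure]_(s in `[0%R, (phi x)%:num]) 1)%E).
  by apply: integral_mono => s _; rewrite lee_fin; case/andP: (f01 (pt x s)).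
rewrite integral_cst//= lebesgue_fibre mul1e lee_fin.
by case/andP: (phi_bounded x).
Qed.

End suspension_measure.

Lemma probability_fin_num d (T : measurableType d) (R : realType)
  (P : probability T R) (A : set T) : measurable A -> P A \is a fin_num.
Proof.
move=> mA; rewrite ge0_fin_numE//.
by apply: le_lt_trans (probability_le1 _ mA) _; rewrite ltry.
Qed.

Lemma Rintegral_indicZ d (T : measurableType d) (R : realType)
    (P : probability T R) (A : set T) (c : R) :
  measurable A -> 0 < c -> \int[P]_x (c * \1_A x) = c * fine (P A).
Proof.
move=> mA c0; rewrite /Rintegral; under eq_integral do rewrite EFinM.
rewrite integralZ//.
by rewrite integral_indic// setIT fineM// probability_fin_num.
Qed.

Lemma measureU3_le d (T : measurableType d) (R : realType)
    (P : {measure set T -> \bar R}) (A B C : set T) (a b c : \bar R) :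
  measurable A -> measurable B -> measurable C ->
  (P A <= a)%E -> (P B <= b)%E -> (P C <= c)%E ->
  (P (A `|` B `|` C) <= a + b + c)%E.
Proof.
move=> mA mB mC Aa Bb Cc; have mAB : measurable (A `|` B) by exact: measurableU.
apply: le_trans (measureU2 _ mAB mC) (leeD _ Cc).
exact: le_trans (measureU2 _ mA mB) (leeD Aa Bb).
Qed.

(** * Comparison of the two correlation integrals *)

Section correlation_bounds.
Context {R : realType} {X : pmetricType R} (T g : X -> X) (phi : X -> {posnum R}).
Context (mu : probability (borel X) R) (nu : probability (borel (susp_space T phi)) R).
Variables (L K m M : R).
Hypotheses (TK : cancel T g) (gK : cancel g T) (L1 : 1 <= L).
Hypothesis T_lip : forall x y, mdist (T x) (T y) <= L * mdist x y.
Hypothesis g_lip : forall x y, mdist (g x) (g y) <= L * mdist x y.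
Hypothesis phi_lip : forall x y, (phi x)%:num - (phi y)%:num <= K * mdist x y.
Hypotheses (K0 : 0 <= K) (m0 : 0 < m).
Hypothesis phi_bounded : forall x, m <= (phi x)%:num <= M.
Hypothesis nuE : is_suspension_measure mu nu.
Hypothesis mu_inv : forall A : set (borel X), measurable A -> mu (T @^-1` A) = mu A.

Let pt := susp_pt T phi.
Let D := bw_dist (T := T) (phi := phi).
Let I := \int[mu]_x (phi x)%:num.
Let c0 := bw_lip_const L K m.
Let m_le x : m <= (phi x)%:num. Proof. by case/andP: (phi_bounded x). Qed.
Let I0 : 0 < I := mean_height_gt0 mu m0 phi_bounded.
Let c0_gt0 : 0 < c0 := bw_lip_const_gt0 L1 K0 m0.

Lemma open_mdist_lt (f : X -> X) x r : (forall y z, mdist (f y) (f z) <= L * mdist y z) ->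
  open [set y | mdist x (f y) < r].
Proof.
move=> f_lip; rewrite openE => y /= yr; apply/nbhs_ballP.
have L0 : 0 < L by apply: lt_le_trans L1.
exists ((r - mdist x (f y)) / L) => /=; first by rewrite divr_gt0// subr_gt0.
move=> z; rewrite ballEmdist /= ltr_pdivlMr// mulrC => yz.
apply: le_lt_trans (metric_triangle x (f y) _) _.
by have := f_lip y z; lra.
Qed.

Lemma continuous_tentr r (y : susp_space T phi) : 0 < r -> continuous (tent r y).
Proof.
move=> r0; apply: continuous_susp.
exact: (tent_lipr TK gK L1 T_lip g_lip phi_lip K0 m0 m_le).
Qed.

Lemma open_bw_ball y r : open [set z | D y z < r].
Proof.
have /continuousP/(_ `]-oo, r[%classic) :=
  continuous_susp (bw_lip TK gK L1 T_lip g_lip phi_lip K0 m0 m_le y).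
have -> : [set z | D y z < r] = D y @^-1` `]-oo, r[.
  by apply/seteqP; split => z; rewrite /= in_itv.
by apply; exact: interval_open.
Qed.

(** For r > 0, a substitute for the [nu]-measure of balls about y, between those of radii r and 2
    r. *)
Definition mean_tent (r : R) (y : susp_space T phi) : R := \int[nu]_z tent r y z.

Lemma mean_tentE r y : (mean_tent r y)%:E = (\int[nu]_z (tent r y z)%:E)%E.
Proof.
rewrite (@Rintegral_bounded _ _ _ _ _ _ 1)//; first exact: probability_setT_lty.
by move=> z _; exact: tent01.
Qed.

Lemma mean_tent01 r y : 0 <= mean_tent r y <= 1.
Proof.
rewrite -!lee_fin mean_tentE; apply/andP; split.
  by apply: integral_ge0 => z _; rewrite lee_fin; case/andP: (tent01 r y z).
rewrite -(probability_setT nu) -[leRHS]mul1e -integral_cst//.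
by apply: integral_mono => z _; rewrite lee_fin; case/andP: (tent01 r y z).
Qed.

Lemma mean_tent_lip r : 0 < r -> susp_lip (c0 / r) (mean_tent r).
Proof.
move=> r0 x s y t sx ty; rewrite lerBlDr addrC.
set e := c0 / r * _.
have itent p : nu.-integrable setT (EFin \o tent r p).
  apply: measurable_bounded_integrable => //.
  - exact: probability_setT_lty.
  - by apply: measurable_borel_fun; exact: continuous_tentr.
  exists 1; split; first exact: num_real.
  move=> B B1 z _; apply: le_trans (ltW B1).
  by have /andP[? ?] := tent01 r p z; rewrite ger0_norm.
have icst : nu.-integrable setT (EFin \o cst e).
  by apply: finite_measure_integrable_cst.
have -> : mean_tent r (pt y t) + e = \int[nu]_z (tent r (pt y t) z + e).
  by rewrite RintegralD// Rintegral_cst// [X in fine X](probability_setT nu) mulr1.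
apply: le_Rintegral => //.
  by have := integrableD measurableT (itent (pt y t)) icst; exact.
move=> z _; rewrite -lerBlDl.
exact: (tent_lipl TK gK L1 T_lip g_lip phi_lip K0 m0 m_le).
Qed.

Lemma continuous_mean_tent r : 0 < r -> continuous (mean_tent r).
Proof. by move=> r0; exact: continuous_susp (mean_tent_lip r0). Qed.

Definition ball_measure (x : X) (r : R) : R := fine (mu [set y | mdist x y < r]).

Lemma measurable_ball x r : measurable ([set y | mdist x y < r] : set (borel X)).
Proof.
apply: measurable_borel_open; apply: (open_mdist_lt (f := id)) => y z.
by rewrite ler_peMl// mdist_ge0.
Qed.

Lemma ball_measureE x r : (ball_measure x r)%:E = mu [set y | mdist x y < r].
Proof. by rewrite fineK// probability_fin_num//; exact: measurable_ball. Qed.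

Lemma ball_measure01 x r : 0 <= ball_measure x r <= 1.
Proof.
rewrite -!lee_fin ball_measureE measure_ge0//=; apply: probability_le1.
exact: measurable_ball.
Qed.

Lemma correlation_integral_base r :
  correlation_integral mu (@mdist R X) r = (\int[mu]_x ball_measure x r)%:E.
Proof.
rewrite -(@Rintegral_bounded _ _ _ _ _ _ 1)//; last 2 first.
- exact: probability_setT_lty.
- by move=> x _; exact: ball_measure01.
by apply: eq_integral => x _; rewrite ball_measureE.
Qed.

Let M0 : 0 < M.
Proof. by case/andP: (phi_bounded point) => /(lt_le_trans m0)/lt_le_trans; exact. Qed.

(** The base points that a small ball centred in the fibre of x can reach, with one set for each
    alternative of [bw_dist_pt_lt]. *)
Definition near_orbit (x : X) (r : R) : set X :=
  [set y | mdist x y < r] `|` [set y | mdist (T x) y < r] `|`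
  [set y | mdist x (T y) < r].

Lemma measurable_near_orbit x r : measurable (near_orbit x r : set (borel X)).
Proof.
apply: measurableU; first by apply: measurableU; exact: measurable_ball.
by apply: measurable_borel_open; exact: open_mdist_lt.
Qed.

(** By invariance the ball about T x has the measure of its preimage, which lies in the ball of
    radius L r about x because [g] is Lipschitz. The third set is itself the preimage of a ball
    about x. *)
Lemma near_orbit_measure x r : 0 < r ->
  fine (mu (near_orbit x r)) <= 3 * ball_measure x (L * r).
Proof.
move=> r0; have mB := measurable_ball; have mN := measurable_near_orbit x r.
have rL : r <= L * r by rewrite ler_peMl// ltW.
have m3 : measurable ([set y | mdist x (T y) < r] : set (borel X)).
  by apply: measurable_borel_open; exact: open_mdist_lt.
rewrite -lee_fin fineK ?probability_fin_num//.
have le_ball : (mu [set y | (mdist x y < r)%R] <= mu [set y | (mdist x y < L * r)%R])%E.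
  by apply: le_measure; rewrite ?inE// => y /= /lt_le_trans; exact.
have b2 : (mu [set y | (mdist (T x) y < r)%R] <= mu [set y | (mdist x y < L * r)%R])%E.
  rewrite -[X in (X <= _)%E]mu_inv//.
  apply: le_measure; rewrite ?inE//.
    apply: measurable_borel_open.
    exact: (open_mdist_lt (T x) r T_lip).
  move=> y /= Txy; have := g_lip (T x) (T y); rewrite !TK => /le_lt_trans; apply.
  by rewrite ltr_pM2l// (lt_le_trans ltr01).
have b3 : (mu [set y | (mdist x (T y) < r)%R] <= mu [set y | (mdist x y < L * r)%R])%E.
  have := mu_inv (mB x r); rewrite /preimage/= => ->; exact: le_ball.
apply: le_trans (measureU3_le _ _ _ le_ball b2 b3) _ => //.
by rewrite -ball_measureE -!EFinD lee_fin; lra.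
Qed.

Lemma lebesgue_itvcc (a b : R) : a <= b ->
  lebesgue_measure [set` `[a, b]] = (b - a)%:E :> \bar R.
Proof.
rewrite lebesgue_measure_itv/= lte_fin le_eqVlt => /predU1P[->|->//].
by rewrite ltxx subrr.
Qed.

Lemma lebesgue_itvcc_le (a b c : R) : a <= b -> b - a <= c ->
  (lebesgue_measure [set` `[a, b]] <= c%:E)%E.
Proof. by move=> ab; rewrite -lee_fin -lebesgue_itvcc. Qed.

(** The tent lives over [near_orbit], and in each fibre on intervals of total length at most 4 delta
    = 8 M r; the factor 3 of [near_orbit_measure] makes this 24 M r. The bound on r makes the
    support radius 2 r at most 1/2. *)
Lemma mean_tent_le x s r : 0 <= s <= (phi x)%:num -> 0 < r -> r <= 4^-1 ->
  mean_tent r (pt x s) <= I^-1 * (24 * M * r * ball_measure x (4 * L ^+ 5 * r)).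
Proof.
move=> sx r0 r4; have L0 : 0 < L := lt_le_trans ltr01 L1.
(* At distance below 2 r the base points move by at most 2 L^4 r, doubled in rho to get a strict
   inequality; delta is the normalised level gap 2 r times the largest height [M]. *)
set rho := 4 * L ^+ 4 * r; set delta := 2 * M * r.
have rho0 : 0 < rho by rewrite !mulr_gt0// exprn_gt0.
have d0 : 0 < delta by rewrite !mulr_gt0.
have d40 : 0 < 4 * delta by rewrite mulr_gt0.
pose U := near_orbit x rho.
apply: (@le_trans _ _ (I^-1 * \int[mu]_y (4 * delta * \1_U y))); last first.
  rewrite ler_pM2l ?invr_gt0// Rintegral_indicZ//; last exact: measurable_near_orbit.
  apply: le_trans (ler_wpM2l (ltW d40) (near_orbit_measure x rho0)) _.
  have -> : L * rho = 4 * L ^+ 5 * r by rewrite /rho; ring.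
  by rewrite /delta le_eqVlt; apply/orP; left; apply/eqP; ring.
apply: (@susp_integral_le _ _ _ _ _ _ m M _ _ _ _ _ (4 * delta)) => //.
- exact: continuous_tentr.
- by move=> y; exact: tent01.
- by move=> y; rewrite ler_piMr ?(ltW d40)// indicE; case: (_ \in _).
move=> y; set py := (phi y)%:num.
have py0 : 0 < py by rewrite /py.
have pyM : py <= M by case/andP: (phi_bounded y).
set t := s / (phi x)%:num.
(* The levels over y left by the three alternatives: around the rescaled level of s, near the floor,
   near the roof. *)
pose A : set R := `[t * py - delta, t * py + delta]%classic `|` `[0, delta]%classic
  `|` `[py - delta, py]%classic.
have mA : measurable A by do 2 apply: measurableU => //.
have lA : (lebesgue_measure A <= (4 * delta)%:E)%E.
  have -> : (4 * delta)%:E = ((2 * delta)%:E + delta%:E + delta%:E)%E.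
    by rewrite -!EFinD; congr EFin; ring.
  by apply: measureU3_le => //; apply: lebesgue_itvcc_le; lra.
have [yU|yU] := pselect (U y); last first.
  rewrite indicE memNset// mulr0 integral0_eq// => s'; rewrite /= in_itv/= => s'y.
  rewrite tent_eq0// leNgt; apply/negP => /(bw_dist_pt_lt TK gK L1 T_lip g_lip sx s'y).
  have r2 : 2 * r <= 2^-1 by lra.
  move=> /(_ r2) h; apply: yU.
  have lt_rho : L ^+ 4 * (2 * r) < rho.
    have : 0 < L ^+ 4 * r by rewrite mulr_gt0// exprn_gt0.
    by rewrite /rho; lra.
  case: h => -[h _].
  - by left; left; apply: le_lt_trans h lt_rho.
  - by left; right; apply: le_lt_trans h lt_rho.
  - by right; apply: le_lt_trans h lt_rho.
rewrite indicE mem_set// mulr1; apply: le_trans lA.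
apply: (@le_trans _ _ (lebesgue_measure (A `&` `[0, py]%classic))); last first.
  by apply: le_measure; rewrite ?inE//; exact: measurableI.
rewrite -integral_indic//; apply: integral_mono => s'.
  by rewrite lee_fin; case/andP: (tent01 r (pt x s) (pt y s')).
rewrite /= in_itv/= lee_fin => s'y; rewrite indicE.
case: (boolP (s' \in A)) => [_|/negP s'A]; first by case/andP: (tent01 r (pt x s) (pt y s')).
rewrite le_eqVlt; apply/orP; left; apply/eqP.
rewrite tent_eq0// leNgt; apply/negP => /(bw_dist_pt_lt TK gK L1 T_lip g_lip sx s'y).
have r2 : 2 * r <= 2^-1 by lra.
have rpy : 2 * r * py <= delta by rewrite /delta mulrAC ler_pM2r// ler_pM2l.
move=> /(_ r2) h; apply: s'A; rewrite inE /A /= !in_itv /=.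
case/andP: s'y => s'0 s'1; rewrite -/py in h s'1.
have s'E : s' = s' / py * py by rewrite divfK// gt_eqF.
move: h; set u := s' / py in s'E *; rewrite -/t => h.
case: h => -[_ h].
- left; left; move: h; rewrite ler_norml => /andP[h1 h2].
  have : (u - t) * py <= 2 * r * py by rewrite ler_pM2r.
  have : - (2 * r) * py <= (u - t) * py by rewrite ler_pM2r.
  by rewrite mulrBl -s'E mulNr; lra.
- left; right; have : u * py <= 2 * r * py by rewrite ler_pM2r.
  by rewrite -s'E; lra.
- right; have : (1 - 2 * r) * py <= u * py by rewrite ler_pM2r.
  by rewrite -s'E mulrBl mul1r; lra.
Qed.

(** Each [I^-1] comes from one use of the formula for [nu]. One [M] belongs to the width of the
    level intervals, the other bounds the fibre length in the outer integral. *)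
Lemma correlation_integral_le r : 0 < r -> r <= 4^-1 ->
  (correlation_integral nu D r <= (I^-1 * (I^-1 * (24 * M * M)) * r)%:E *
     correlation_integral mu (@mdist R X) (4 * L ^+ 5 * r))%E.
Proof.
move=> r0 r4; apply: (@le_trans _ _ (\int[nu]_y mean_tent r y)%:E).
  rewrite -(@Rintegral_bounded _ _ _ _ _ _ 1)//; last 2 first.
  - exact: probability_setT_lty.
  - by move=> y _; exact: mean_tent01.
  apply: integral_mono => [//|y _]; rewrite mean_tentE.
  have mB : measurable ([set z | D y z < r] : set (borel (susp_space T phi))).
    by apply: measurable_borel_open; exact: open_bw_ball.
  rewrite -[X in nu X]setIT -integral_indic//; apply: integral_mono => z _.
    by rewrite lee_fin.
  rewrite lee_fin indicE; case: (boolP (z \in _)) => [|_].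
    by rewrite inE /= => zr; rewrite tent_eq1.
  by case/andP: (tent01 r y z).
set k := 4 * L ^+ 5 * r; set c := 24 * M * r.
have c_gt0 : 0 < c by rewrite !mulr_gt0.
have e0 : 0 < I^-1 * (c * M) by rewrite !mulr_gt0// invr_gt0.
rewrite correlation_integral_base -EFinM lee_fin.
have b01 x := ball_measure01 x k.
have -> : I^-1 * (I^-1 * (24 * M * M)) * r * \int[mu]_x ball_measure x k =
    I^-1 * \int[mu]_x (I^-1 * (c * M) * ball_measure x k).
  rewrite [in RHS]/Rintegral; under [in RHS]eq_integral do rewrite EFinM.
  rewrite integralZ//; last by move=> x; rewrite lee_fin; case/andP: (b01 x).
  rewrite (@Rintegral_bounded _ _ _ _ _ _ 1)//; last exact: probability_setT_lty.
  by rewrite -EFinM /= /c; ring.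
apply: (@susp_integral_le _ _ _ _ _ _ m M _ _ _ _ _ (I^-1 * (c * M))) => //.
- exact: continuous_mean_tent.
- by move=> y; exact: mean_tent01.
- by move=> x; rewrite ler_piMr ?(ltW e0)//; case/andP: (b01 x).
move=> x; have bx0 : 0 <= ball_measure x k by case/andP: (b01 x).
apply: (@le_trans _ _ (\int[lebesgue_measure]_(s in `[0%R, (phi x)%:num])
    (I^-1 * (c * ball_measure x k))%:E)%E).
  apply: integral_mono => s; rewrite /= in_itv/= lee_fin.
    by case/andP: (mean_tent01 r (pt x s)).
  by move=> sx; exact: mean_tent_le.
rewrite integral_cst//= lebesgue_fibre -EFinM lee_fin.
have -> : I^-1 * (c * M) * ball_measure x k = I^-1 * (c * ball_measure x k) * M by ring.
rewrite ler_wpM2l//; last by case/andP: (phi_bounded x).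
by rewrite mulr_ge0 ?invr_ge0 ?(ltW I0)// mulr_ge0// ltW.
Qed.

(** Since s + eta <= m, the interval [s, s + eta] lies in every fibre. Over the ball of radius eta
    about x its points are within c0 (eta + eta) of (x, s), where the tent is 1. *)
Lemma mean_tent_ge x s eta : 0 <= s <= m / 2 -> 0 < eta <= m / 2 ->
  I^-1 * (eta * ball_measure x eta) <= mean_tent (2 * c0 * eta) (pt x s).
Proof.
move=> /andP[s0 s1] /andP[e0 e1].
have r0 : 0 < 2 * c0 * eta by rewrite !mulr_gt0.
have -> : eta * ball_measure x eta = \int[mu]_y (eta * \1_[set y | mdist x y < eta] y).
  by rewrite Rintegral_indicZ//; exact: measurable_ball.
apply: (@susp_integral_ge _ _ _ _ _ _ m M) => //.
- exact: continuous_tentr.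
- by move=> y; exact: tent01.
- by move=> y; rewrite mulr_ge0// ltW.
move=> y; rewrite indicE; case: (boolP (y \in _)) => [|_]; last first.
  rewrite mulr0; apply: integral_ge0 => t _; rewrite lee_fin.
  by case/andP: (tent01 (2 * c0 * eta) (pt x s) (pt y t)).
rewrite inE /= mulr1 => xy; have my := m_le y; have mx := m_le x.
have -> : eta%:E = lebesgue_measure (`[s, s + eta]%classic `&` `[0, (phi y)%:num]%classic).
  rewrite setIidl; last first.
    by move=> t /=; rewrite !in_itv/=; lra.
  by rewrite lebesgue_itvcc; [congr EFin; ring|lra].
rewrite -integral_indic//; apply: integral_mono => t; first by rewrite lee_fin.
rewrite /= in_itv/= lee_fin indicE => ty.
case: (boolP (t \in _)) => [|_]; last by case/andP: (tent01 (2 * c0 * eta) (pt x s) (pt y t)).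
rewrite inE /= in_itv/= => /andP[st te]; rewrite tent_eq1//.
have sx : 0 <= s <= (phi x)%:num by lra.
apply: le_lt_trans (bw_dist_pt_le TK gK L1 T_lip g_lip phi_lip K0 m0 m_le sx ty) _.
rewrite -/c0 [2 * c0]mulrC -mulrA ltr_pM2l// ger0_norm ?subr_ge0//.
by lra.
Qed.

(** Restricting the outer fibre integral to the levels in [0, m / 2] gives the factor m / 2. The
    radius doubles to 4 c0 eta because a tent reaches twice its scale. *)
Lemma correlation_integral_ge eta : 0 < eta <= m / 2 ->
  ((I^-1 * (I^-1 * (m / 2)) * eta)%:E * correlation_integral mu (@mdist R X) eta <=
   correlation_integral nu D (4 * c0 * eta))%E.
Proof.
move=> /andP[e0 e1]; set r := 2 * c0 * eta.
have r0 : 0 < r by rewrite !mulr_gt0.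
apply: (@le_trans _ _ (\int[nu]_y mean_tent r y)%:E); last first.
  rewrite -(@Rintegral_bounded _ _ _ _ _ _ 1)//; last 2 first.
  - exact: probability_setT_lty.
  - by move=> y _; exact: mean_tent01.
  apply: integral_mono => y _; first by rewrite lee_fin; case/andP: (mean_tent01 r y).
  rewrite mean_tentE.
  have mB : measurable ([set z | D y z < 4 * c0 * eta] : set (borel (susp_space T phi))).
    by apply: measurable_borel_open; exact: open_bw_ball.
  rewrite -[X in nu X]setIT -integral_indic//; apply: integral_mono => z _.
    by rewrite lee_fin; case/andP: (tent01 r y z).
  rewrite lee_fin indicE; case: (boolP (z \in _)) => [_|/negP].
    by case/andP: (tent01 r y z).
  rewrite inE /= => /negP; rewrite -leNgt => zr; rewrite tent_eq0//.
  by apply: le_trans zr; rewrite /r; lra.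
have e20 : 0 < I^-1 * (m / 2 * eta) by rewrite !mulr_gt0// invr_gt0.
rewrite correlation_integral_base -EFinM lee_fin.
have b01 x := ball_measure01 x eta.
have -> : I^-1 * (I^-1 * (m / 2)) * eta * \int[mu]_x ball_measure x eta =
    I^-1 * \int[mu]_x (I^-1 * (m / 2 * eta) * ball_measure x eta).
  rewrite [in RHS]/Rintegral; under [in RHS]eq_integral do rewrite EFinM.
  rewrite integralZ//; last by move=> x; rewrite lee_fin; case/andP: (b01 x).
  rewrite (@Rintegral_bounded _ _ _ _ _ _ 1)//; last exact: probability_setT_lty.
  by rewrite -EFinM /=; ring.
apply: (@susp_integral_ge _ _ _ _ _ _ m M) => //.
- exact: continuous_mean_tent.
- by move=> y; exact: mean_tent01.
- by move=> x; apply: mulr_ge0; [exact: ltW|case/andP: (b01 x)].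
move=> x; have bx0 : 0 <= ball_measure x eta by case/andP: (b01 x).
have mx := m_le x.
apply: (@le_trans _ _ (\int[lebesgue_measure]_(s in `[0%R, (m / 2)%R])
    (I^-1 * (eta * ball_measure x eta))%:E)%E).
  rewrite integral_cst//= lebesgue_itvcc; last by rewrite divr_ge0// ltW.
  by rewrite -EFinM lee_fin subr0 le_eqVlt; apply/orP; left; apply/eqP; ring.
apply: (@le_trans _ _ (\int[lebesgue_measure]_(s in `[0%R, (m / 2)%R])
    (mean_tent r (pt x s))%:E)%E).
  apply: integral_mono => s; rewrite /= in_itv/= lee_fin => sm.
    by rewrite mulr_ge0 ?invr_ge0 ?(ltW I0)// mulr_ge0// ltW.
  by apply: mean_tent_ge; rewrite ?e0.
rewrite integral_mkcond [leRHS]integral_mkcond; apply: integral_mono => s _.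
  by rewrite patchE; case: ifP => // _; rewrite lee_fin; case/andP: (mean_tent01 r (pt x s)).
rewrite !patchE; case: ifP => [|_].
  rewrite inE /= in_itv/= => sm; rewrite ifT// inE /= in_itv/=.
  by lra.
by case: ifP => // _; rewrite lee_fin; case/andP: (mean_tent01 r (pt x s)).
Qed.

End correlation_bounds.

(** * Exponents at 0 and their behaviour under multiplication by r *)

Section limits.
Context {R : realType}.

Lemma nbhs0rP (P : R -> Prop) :
  (\forall r \near 0^'+, P r) <->
  exists2 d : R, 0 < d & forall r, 0 < r -> r < d -> P r.
Proof.
split=> [|[d d0 dP]].
  move=> /nbhs_ballP[d /= d0 dP]; exists d => // r r0 rd.
  by apply: dP => //; rewrite /ball /= sub0r normrN gtr0_norm.
apply/nbhs_ballP; exists d => //= r; rewrite /ball /= sub0r normrN => rd r0.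
by apply: dP => //; apply: le_lt_trans (ler_norm r) rd.
Qed.

Lemma ereal_dense (x y : \bar R) : (x < y)%E ->
  exists r : R, (x < r%:E)%E /\ (r%:E < y)%E.
Proof.
case: x y => [a| |] [b| |] //.
- by rewrite lte_fin => ab; exists ((a + b) / 2); rewrite !lte_fin; lra.
- by move=> _; exists (a + 1); rewrite lte_fin ltry; lra.
- by move=> _; exists (b - 1); rewrite lte_fin ltNyr; lra.
- by move=> _; exists 0; rewrite ltry ltNyr.
Qed.

(** Testing against real a and b also handles infinite [C]: one of the two conditions is then
    vacuous. *)
Lemma limf_einf_esupP (f : R -> \bar R) (C : \bar R) :
  (limf_einf f 0^'+ = C /\ limf_esup f 0^'+ = C) <->
  (forall a, (a%:E < C)%E -> \forall r \near 0^'+, (a%:E < f r)%E) /\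
  (forall b, (C < b%:E)%E -> \forall r \near 0^'+, (f r < b%:E)%E).
Proof.
rewrite limf_einfE limf_esupE; split.
  move=> [infC supC]; split=> [a|b].
    rewrite -infC => /ereal_sup_gt[_ [V V0 <-] aV].
    apply: filterS V0 => r Vr; apply: lt_le_trans aV _.
    by apply: ereal_inf_lbound; exists r.
  rewrite -supC => /ereal_inf_lt[_ [V V0 <-] Vb].
  apply: filterS V0 => r Vr; apply: le_lt_trans Vb.
  by apply: ereal_sup_ubound; exists r.
move=> [lo hi].
set i := ereal_sup _; set s := ereal_inf _.
have Ci : (C <= i)%E.
  rewrite leNgt; apply/negP => /ereal_dense[a [ia aC]].
  move: ia; apply/negP; rewrite -leNgt.
  apply: (@le_trans _ _ (ereal_inf [set f r | r in [set r | (a%:E < f r)%E]])).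
    by apply: le_ereal_inf_tmp => _ [r /= ar <-]; exact: ltW.
  by apply: ereal_sup_ubound; exists [set r | (a%:E < f r)%E] => //; exact: lo.
have sC : (s <= C)%E.
  rewrite leNgt; apply/negP => /ereal_dense[b [Cb bs]].
  move: bs; apply/negP; rewrite -leNgt.
  apply: (@le_trans _ _ (ereal_sup [set f r | r in [set r | (f r < b%:E)%E]])).
    by apply: ereal_inf_lbound; exists [set r | (f r < b%:E)%E] => //; exact: hi.
  by apply: ge_ereal_sup => _ [r /= ar <-]; exact: ltW.
have is_ : (i <= s)%E.
  apply: ge_ereal_sup => _ [V V0 <-]; apply: le_ereal_inf_tmp => _ [W W0 <-].
  have [r [Vr Wr]] := filter_ex (filterI V0 W0).
  apply: (@le_trans _ _ (f r)); first by apply: ereal_inf_lbound; exists r.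
  by apply: ereal_sup_ubound; exists r.
by split; apply/eqP; rewrite eq_le ?Ci ?sC ?andbT/= (le_trans is_ sC, le_trans Ci is_).
Qed.

(** Division by ln r < 0 reverses inequalities. At x <= 0 the logarithm is -oo and the quotient +oo,
    which agrees with x lying below every power of r. *)
Let lneE (x : \bar R) (r a : R) : 0 < r -> r < 1 ->
  ((a%:E < lne x / (ln r)%:E)%E = (x < (r `^ a)%:E)%E) *
  ((lne x / (ln r)%:E < a%:E)%E = ((r `^ a)%:E < x)%E).
Proof.
move=> r0 r1; have lr0 : ln r < 0 by apply: ln_lt0; rewrite r0.
have lri0 : (ln r)^-1 < 0 by rewrite invr_lt0.
have ra0 : 0 < r `^ a by exact: powR_gt0.
have lra : ln (r `^ a) = a * ln r by rewrite ln_powR.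
rewrite inver lt_eqF//; case: x => [x| |] /=.
- case: ifPn => [x0|]; last first.
    rewrite -ltNge => x0; rewrite -EFinM !lte_fin.
    by rewrite ltr_ndivlMr// ltr_ndivrMr// -lra !ltr_ln ?posrE.
  rewrite ![(_ * (_^-1)%:E)%E]muleC lt0_muleNy ?lte_fin//; split.
    by rewrite ltry (le_lt_trans x0 ra0).
  by rewrite [LHS]ltNge leey; apply/esym/negbTE; rewrite -leNgt (le_trans x0)// ltW.
- by rewrite ![(_ * (_^-1)%:E)%E]muleC lt0_muley ?lte_fin//; split;
    rewrite ?ltNyr ?ltry// ltNge ?leNye ?leey.
- by rewrite ![(_ * (_^-1)%:E)%E]muleC lt0_muleNy ?lte_fin//; split;
    rewrite ?ltNyr ?ltry// ltNge ?leNye ?leey.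
Qed.

(** Removes the logarithms: comparison with powers of r is insensitive to constant factors and to
    rescaling of r. *)
Lemma log_ratio_limP (J : R -> \bar R) (C : \bar R) :
  let ratio r := (lne (J r) / (ln r)%:E)%E in
  (limf_einf ratio 0^'+ = C /\ limf_esup ratio 0^'+ = C) <->
  (forall a, (a%:E < C)%E ->
     exists2 d : R, 0 < d & forall r, 0 < r -> r < d -> (J r < (r `^ a)%:E)%E) /\
  (forall b, (C < b%:E)%E ->
     exists2 d : R, 0 < d & forall r, 0 < r -> r < d -> ((r `^ b)%:E < J r)%E).
Proof.
move=> ratio; rewrite limf_einf_esupP.
have lt1 d : 0 < d -> exists2 d', 0 < d' & d' <= d /\ d' <= 1 :> R.
  by move=> d0; exists (Num.min d 1); rewrite ?lt_min ?d0//= !ge_min !lexx orbT.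
split=> -[lo hi]; split=> a aC.
- have /nbhs0rP[d /lt1[d' d'0 [d'd d'1]] h] := lo _ aC.
  exists d' => // r r0 rd'; rewrite -(lneE (J r) a r0 (lt_le_trans rd' d'1)).1.
  by apply: h => //; exact: lt_le_trans d'd.
- have /nbhs0rP[d /lt1[d' d'0 [d'd d'1]] h] := hi _ aC.
  exists d' => // r r0 rd'; rewrite -(lneE (J r) a r0 (lt_le_trans rd' d'1)).2.
  by apply: h => //; exact: lt_le_trans d'd.
- have [d /lt1[d' d'0 [d'd d'1]] h] := lo _ aC; apply/nbhs0rP.
  exists d' => // r r0 rd'; rewrite (lneE (J r) a r0 (lt_le_trans rd' d'1)).1.
  by apply: h => //; exact: lt_le_trans d'd.
- have [d /lt1[d' d'0 [d'd d'1]] h] := hi _ aC; apply/nbhs0rP.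
  exists d' => // r r0 rd'; rewrite (lneE (J r) a r0 (lt_le_trans rd' d'1)).2.
  by apply: h => //; exact: lt_le_trans d'd.
Qed.

Lemma powR_small (A e : R) : 0 < A -> 0 < e ->
  exists2 d : R, 0 < d & forall r, 0 < r -> r < d -> r `^ e < A.
Proof.
move=> A0 e0; exists (A `^ e^-1); first exact: powR_gt0.
move=> r r0 rd; have -> : A = (A `^ e^-1) `^ e.
  by rewrite -powRrM mulVf ?gt_eqF// powRr1// ltW.
by apply: gt0_ltr_powR => //; rewrite nnegrE ?ltW// powR_gt0.
Qed.

Let powR_gt0D (r x y : R) : 0 < r -> r `^ (x + y) = r `^ x * r `^ y.
Proof. by move=> r0; rewrite powRD// (gt_eqF r0) implybT. Qed.

(** The spare exponent 1 + p - a > 0 absorbs the constant c k^p for small r. *)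
Lemma powR_cmp_small (c k p a : R) : 0 < c -> 0 < k -> a < 1 + p ->
  exists2 d : R, 0 < d & forall r, 0 < r -> r < d ->
    c * r * (k * r) `^ p < r `^ a.
Proof.
move=> c0 k0 ap; have ck0 : 0 < c * k `^ p by rewrite mulr_gt0// powR_gt0.
have e0 : 0 < 1 + p - a by lra.
have cki0 : 0 < (c * k `^ p)^-1 by rewrite invr_gt0.
have [d d0 h] := powR_small cki0 e0; exists d => // r r0 rd.
have := h r r0 rd; rewrite -[_^-1]mul1r ltr_pdivlMr// => h'.
rewrite powRM ?ltW//.
have -> : c * r * (k `^ p * r `^ p) = r `^ (1 + p - a) * (c * k `^ p) * r `^ a.
  have -> : r `^ p = r `^ (1 + p - a) * r `^ a * r^-1.
    rewrite -powR_gt0D// subrK powR_gt0D// powRr1 ?ltW//.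
    by rewrite mulrAC divff ?gt_eqF// mul1r.
  by field; rewrite gt_eqF.
by rewrite gtr_pMl// powR_gt0.
Qed.

Lemma powR_cmp_large (c k p b : R) : 0 < c -> 0 < k -> 1 + p < b ->
  exists2 d : R, 0 < d & forall r, 0 < r -> r < d ->
    r `^ b < c * r * (k * r) `^ p.
Proof.
move=> c0 k0 pb; have ck0 : 0 < c * k `^ p by rewrite mulr_gt0// powR_gt0.
have e0 : 0 < b - (1 + p) by lra.
have [d d0 h] := powR_small ck0 e0; exists d => // r r0 rd.
have h' := h r r0 rd.
have -> : r `^ b = r `^ (b - (1 + p)) * (r * r `^ p).
  rewrite -[in RHS](subrK (1 + p) b) addrK.
  by rewrite -[in LHS](subrK (1 + p) b) !powR_gt0D// powRr1// ltW.
rewrite powRM ?ltW// [ltRHS](_ : _ = c * k `^ p * (r * r `^ p)); last by ring.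
by rewrite ltr_pM2r// mulr_gt0// powR_gt0.
Qed.

Lemma log_ratio_lim_shift (J J' : R -> \bar R) (C : \bar R) (c k c' k' r1 : R) :
  0 < c -> 0 < k -> 0 < c' -> 0 < k' -> 0 < r1 ->
  (forall r, 0 < r -> r < r1 -> (J' r <= (c * r)%:E * J (k * r)%R)%E) ->
  (forall r, 0 < r -> r < r1 -> ((c' * r)%:E * J (k' * r)%R <= J' r)%E) ->
  limf_einf (fun r => lne (J r) / (ln r)%:E)%E 0^'+ = C /\
  limf_esup (fun r => lne (J r) / (ln r)%:E)%E 0^'+ = C ->
  limf_einf (fun r => lne (J' r) / (ln r)%:E)%E 0^'+ = (C + 1)%E /\
  limf_esup (fun r => lne (J' r) / (ln r)%:E)%E 0^'+ = (C + 1)%E.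
Proof.
move=> c0 k0 c'0 k'0 r10 up low /log_ratio_limP[lo hi]; apply/log_ratio_limP.
split=> [a aC|b Cb].
  (* A real p strictly between a - 1 and [C] leaves the spare exponent that absorbs c and k. *)
  have /ereal_dense[p [ap pC]] : ((a - 1)%:E < C)%E.
    move: aC; case: (C) => [x|_|//]; last exact: ltry.
    by rewrite -EFinD !lte_fin; lra.
  have [d d0 h] := lo _ pC.
  have a1p : a < 1 + p by move: ap; rewrite lte_fin; lra.
  have [e e0 he] := powR_cmp_small c0 k0 a1p.
  exists (Num.min (Num.min (d / k) e) r1); first by rewrite !lt_min divr_gt0// e0.
  move=> r r0; rewrite !lt_min => /andP[/andP[rd re] rr1].
  apply: le_lt_trans (up r r0 rr1) _.
  have kr0 : 0 < k * r by rewrite mulr_gt0.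
  have krd : k * r < d by rewrite mulrC -ltr_pdivlMr.
  apply: (@lt_trans _ _ ((c * r)%:E * ((k * r) `^ p)%:E)%E).
    by rewrite lte_pmul2l// ?lte_fin ?mulr_gt0//; exact: h.
  by rewrite -EFinM lte_fin; exact: he.
have /ereal_dense[p [Cp pb]] : (C < (b - 1)%:E)%E.
  move: Cb; case: (C) => [x|//|_]; last exact: ltNyr.
  by rewrite -EFinD !lte_fin; lra.
have [d d0 h] := hi _ Cp.
have p1b : 1 + p < b by move: pb; rewrite lte_fin; lra.
have [e e0 he] := powR_cmp_large c'0 k'0 p1b.
exists (Num.min (Num.min (d / k') e) r1); first by rewrite !lt_min divr_gt0// e0.
move=> r r0; rewrite !lt_min => /andP[/andP[rd re] rr1].
apply: lt_le_trans (low r r0 rr1).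
have kr0 : 0 < k' * r by rewrite mulr_gt0.
have krd : k' * r < d by rewrite mulrC -ltr_pdivlMr.
apply: (@lt_trans _ _ ((c' * r)%:E * ((k' * r) `^ p)%:E)%E).
  by rewrite -EFinM lte_fin; exact: he.
by rewrite lte_pmul2l// ?lte_fin ?mulr_gt0//; exact: h.
Qed.

End limits.

(** * Consequences of compactness, and the conclusion *)

Lemma compact_bounded_fun (R : realType) (X : pmetricType R) (f : X -> R) :
  compact [set: X] -> continuous f -> exists B, forall x, f x <= B.
Proof.
move=> cX cf; have /compact_bounded[B [_ hB]] : compact (range f).
  by apply: continuous_compact => //; exact: continuous_subspaceT.
exists (B + 1) => x; apply: le_trans (ler_norm _) _.
by apply: hB; [rewrite ltrDl|exists x].
Qed.

Lemma continuous_mlipschitz (R : realType) (X : pmetricType R) (f : X -> R) (K : R) :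
  (forall x y, f x - f y <= K * mdist x y) -> continuous f.
Proof.
move=> f_lip x; apply/cvgrPdist_lt => e e0.
have K0 : 0 < `|K| + 1 by have := normr_ge0 K; lra.
have d0 : 0 < e / (`|K| + 1) by rewrite divr_gt0.
near=> y.
have xy : mdist x y < e / (`|K| + 1).
  have : ball x (e / (`|K| + 1)) y by near: y; exact: nbhsx_ballx.
  by rewrite ballEmdist.
have Ke : K * mdist x y < e.
  rewrite ltr_pdivlMr// mulrC in xy; apply: le_lt_trans xy.
  by rewrite ler_wpM2r ?mdist_ge0//; have := ler_norm K; lra.
have h1 := f_lip x y; have := f_lip y x; rewrite metric_sym => h2.
by rewrite ltr_norml; lra.
Unshelve. all: by end_near.
Qed.

(** The lower bound is the inverse of an upper bound for the continuous function 1 / phi. *)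
Lemma positive_lipschitz_bounds (R : realType) (X : pmetricType R)
    (phi : X -> {posnum R}) (K : R) :
  compact [set: X] -> (forall x y, (phi x)%:num - (phi y)%:num <= K * mdist x y) ->
  exists m M, 0 < m /\ forall x, m <= (phi x)%:num <= M.
Proof.
move=> cX phi_lip; have cphi := continuous_mlipschitz phi_lip.
have [M hM] := compact_bounded_fun cX cphi.
have cV : continuous (fun x => (phi x)%:num^-1).
  by move=> x; apply: cvgV; [rewrite gt_eqF|exact: cphi].
have [B hB] := compact_bounded_fun cX cV.
have B0 : 0 < B by apply: lt_le_trans (hB point); rewrite invr_gt0.
exists B^-1, M; split; first by rewrite invr_gt0.
by move=> x; rewrite hM andbT -[leRHS]invrK lef_pV2 ?posrE ?invr_gt0.
Qed.

Theorem theorem4p3 (R : realType) (X : pmetricType R) (T : X -> X)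
    (mu : probability (borel X) R) (phi : X -> {posnum R})
    (nu : probability (borel (susp_space T phi)) R) (C : \bar R) :
  compact [set: X] ->
  bilipschitz T ->
  (forall A : set (borel X), measurable A -> mu (T @^-1` A) = mu A) ->
  has_correlation_dimension mu (@mdist R X) C ->
  mlipschitz (fun x => (phi x)%:num : R^o) ->
  is_suspension_measure mu nu ->
  has_correlation_dimension nu (@bw_dist R X T phi) (C + 1)%E.
Proof.
move=> cX [[K1 T_lip1] [g [TK gK [K2 g_lip1]]]] mu_inv muC [K3 phi_lip1] nuE.
(* One constant for [T] and its inverse, at least 1; the given constants may have any sign. *)
pose L := 1 + `|K1| + `|K2|; have L1 : 1 <= L by rewrite /L -addrA lerDl addr_ge0.
have L0 : 0 < L := lt_le_trans ltr01 L1.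
have T_lip x y : mdist (T x) (T y) <= L * mdist x y.
  apply: le_trans (T_lip1 x y) _; rewrite ler_wpM2r ?mdist_ge0// /L.
  by have := ler_norm K1; have := normr_ge0 K2; lra.
have g_lip x y : mdist (g x) (g y) <= L * mdist x y.
  apply: le_trans (g_lip1 x y) _; rewrite ler_wpM2r ?mdist_ge0// /L.
  by have := ler_norm K2; have := normr_ge0 K1; lra.
have phi_lip x y : (phi x)%:num - (phi y)%:num <= `|K3| * mdist x y.
  apply: le_trans (_ : _ <= K3 * mdist x y) _; last by rewrite ler_wpM2r ?mdist_ge0 ?ler_norm.
  by rewrite metric_sym; apply: le_trans (ler_norm _) (phi_lip1 y x).
have [m [M [m0 phi_bounded]]] := positive_lipschitz_bounds cX phi_lip.
have K0 := normr_ge0 K3.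
have c0 := bw_lip_const_gt0 L1 K0 m0; set c := bw_lip_const _ _ _ in c0.
have M0 : 0 < M by case/andP: (phi_bounded point) => /(lt_le_trans m0)/lt_le_trans h /h.
have I0 := mean_height_gt0 mu m0 phi_bounded; set I := Rintegral _ _ _ in I0.
(* 1/4 serves the upper bound; 2 c m makes eta = r / (4 c) at most m / 2 in the lower one. *)
have r0 : 0 < Num.min 4^-1 (2 * c * m) by rewrite lt_min invr_gt0 ltr0n !mulr_gt0.
have up r : 0 < r -> r < Num.min 4^-1 (2 * c * m) ->
    (correlation_integral nu (bw_dist (phi:=phi)) r <=
     (I^-1 * (I^-1 * (24 * M * M)) * r)%:E *
       correlation_integral mu (@mdist R X) (4 * L ^+ 5 * r))%E.
  move=> r_gt0; rewrite lt_min => /andP[r4 _].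
  exact: (correlation_integral_le TK gK L1 T_lip g_lip phi_lip K0 m0 phi_bounded nuE mu_inv
    r_gt0 (ltW r4)).
have low r : 0 < r -> r < Num.min 4^-1 (2 * c * m) ->
    ((I^-1 * (I^-1 * (m / 2)) / (4 * c) * r)%:E *
       correlation_integral mu (@mdist R X) ((4 * c)^-1 * r) <=
     correlation_integral nu (bw_dist (phi:=phi)) r)%E.
  move=> r_gt0; rewrite lt_min => /andP[_ rm].
  have c40 : 0 < 4 * c by rewrite mulr_gt0.
  have eta : 0 < (4 * c)^-1 * r <= m / 2.
    by rewrite mulr_gt0 ?invr_gt0//= mulrC ler_pdivrMr//; lra.
  have := correlation_integral_ge TK gK L1 T_lip g_lip phi_lip K0 m0 phi_bounded nuE eta.
  by rewrite -/c mulVKf ?gt_eqF// [X in (X%:E * _)%E]mulrA.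
apply: (log_ratio_lim_shift _ _ _ _ r0 up low muC).
- by rewrite !mulr_gt0 ?invr_gt0.
- by rewrite mulr_gt0// exprn_gt0.
- by rewrite !mulr_gt0 ?invr_gt0// mulr_gt0.
- by rewrite invr_gt0 mulr_gt0.
Qed.
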